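(* For every integer $d\ge1$ and every $\alpha\in(0,1]$ there exists a constant $C_{[d,\alpha]}$, depending only on $d$ and $\alpha$, such that the following holds. Let $1\le m\le d$ be an integer and let $f:[0,1]^d\to\mathbb{R}^m$ be a $\mathcal{C}^{1,\alpha}$ function. Then there exists $\varepsilon_0>0$ (which may depend on $f$) such that for every $\varepsilon\in(0,\varepsilon_0)$, $$\mathcal{N}_f(\varepsilon)\le C_{[d,\alpha]}\cdot\left(\frac{\|Df\|_{\mathcal{C}^{0,\alpha}}}{\varepsilon}\right)^{1/\alpha}.$$
   Context: For $g\in\mathcal{C}^1([0,1]^d,\mathbb{R}^m)$ with Jacobian matrix $Dg(x)\in\mathbb{R}^{m\times d}$, the critical set is $\Sigma_g=\{x\in(0,1)^d:\operatorname{rank}(Dg(x))\le m-1\}$. For $f\in\mathcal{C}^1([0,1]^d,\mathbb{R}^m)$ and $\varepsilon>0$, $$\mathcal{N}_f(\varepsilon)=\inf\left\{\mathcal{H}^{d-1}(\Sigma_g): g\in\mathcal{C}^1([0,1]^d,\mathbb{R}^m),\ \|g-f\|_{\mathcal{C}^1}\le\varepsilon\right\},$$ where $\mathcal{H}^{d-1}$ is the $(d-1)$-dimensional Hausdorff measure and $\|h\|_{\mathcal{C}^1}=\sup_{x\in[0,1]^d}|h(x)|+\sup_{x\in[0,1]^d}|Dh(x)|$, with $|\cdot|$ the Euclidean norm on vectors and the operator norm on matrices. A function $f$ is $\mathcal{C}^{1,\alpha}$ if it is $\mathcal{C}^1$ and $\|Df\|_{\mathcal{C}^{0,\alpha}}<\infty$,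 where $$\|Df\|_{\mathcal{C}^{0,\alpha}}=\sup_{x\ne y\in[0,1]^d}\frac{|Df(x)-Df(y)|}{|x-y|^\alpha}.$$ *)

(* Defs.v *)
From mathcomp Require Export all_boot all_order all_algebra.
From mathcomp Require Export all_classical all_reals all_analysis.

Set Implicit Arguments.
Unset Strict Implicit.
Unset Printing Implicit Defensive.

Import Order.TTheory GRing.Theory Num.Theory.
Import numFieldNormedType.Exports.

Local Open Scope classical_set_scope.
Local Open Scope ring_scope.

(* Points of R^n are column vectors, so that Jacobian matrices are m x d.
   The library norm `|v| on matrices is the max norm, hence the two norms
   below. *)
Definition enorm (R : realType) (n : nat) (v : 'cV[R]_n) : R :=
  Num.sqrt (\sum_(i < n) v i 0 ^+ 2).

Definition opnorm (R : realType) (m n : nat) (A : 'M[R]_(m, n)) : R :=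
  sup [set enorm (A *m v) | v in [set v : 'cV[R]_n | enorm v <= 1]].

Definition cube (R : realType) (d : nat) : set 'cV[R]_d :=
  [set x | forall i, 0 <= x i 0 <= 1].

Definition open_cube (R : realType) (d : nat) : set 'cV[R]_d :=
  [set x | forall i, 0 < x i 0 < 1].

Arguments cube : clear implicits.
Arguments open_cube : clear implicits.

(* A function on [0,1]^d is represented by a function on R^d whose values
   outside the cube are irrelevant. Differentiability is therefore taken
   relative to the closed cube, boundary points included; the library's
   differential would also depend on the values outside the cube. *)
Definition has_jacobian (R : realType) (d m : nat) (f : 'cV[R]_d -> 'cV[R]_m)
    (x : 'cV[R]_d) (A : 'M[R]_(m, d)) : Prop :=
  enorm (f y - f x - A *m (y - x)) / enorm (y - x)
    @[y --> within (cube R d) x^'] --> (0 : R).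

(* At a point of the cube, at most one matrix satisfies [has_jacobian]. The
   default value 0 is only taken where there is none. *)
Definition jac (R : realType) (d m : nat) (f : 'cV[R]_d -> 'cV[R]_m)
    (x : 'cV[R]_d) : 'M[R]_(m, d) :=
  xget 0 [set A | has_jacobian f x A].

Definition C1 (R : realType) (d m : nat) (f : 'cV[R]_d -> 'cV[R]_m) : Prop :=
  (forall x, cube R d x -> exists A, has_jacobian f x A) /\
  {within cube R d, continuous (jac f)}.

Definition C1norm (R : realType) (d m : nat) (h : 'cV[R]_d -> 'cV[R]_m) :
    \bar R :=
  (ereal_sup [set (enorm (h x))%:E | x in cube R d] +
   ereal_sup [set (opnorm (jac h x))%:E | x in cube R d])%E.

Definition jac_holder (R : realType) (d m : nat) (alpha : R)
    (f : 'cV[R]_d -> 'cV[R]_m) : \bar R :=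
  ereal_sup [set (opnorm (jac f xy.1 - jac f xy.2)
                  / enorm (xy.1 - xy.2) `^ alpha)%:E
            | xy in [set xy | [/\ cube R d xy.1, cube R d xy.2
                                & xy.1 <> xy.2]]].

Definition C1alpha (R : realType) (d m : nat) (alpha : R)
    (f : 'cV[R]_d -> 'cV[R]_m) : Prop :=
  C1 f /\ (jac_holder alpha f < +oo)%E.

Definition ediam (R : realType) (n : nat) (E : set 'cV[R]_n) : \bar R :=
  ereal_sup [set (enorm (xy.1 - xy.2))%:E | xy in E `*` E].

(* Volume of the k-dimensional unit ball, pi^(k/2) / Gamma (k/2 + 1). *)
Fixpoint unit_ball_volume (R : realType) (k : nat) : R :=
  match k with
  | 0 => 1
  | 1 => 2
  | j.+2 => 2 * pi / j.+2%:R * unit_ball_volume R j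
  end.

(* Empty sets in a cover cost nothing, whereas a nonempty set costs 1 when
   k = 0 (0 ^+ 0 = 1), so that the 0-dimensional measure counts points. *)
Definition diam_pow (R : realType) (n k : nat) (E : set 'cV[R]_n) : \bar R :=
  if E == set0 then 0%E else (ediam E ^+ k)%E.

Definition hausdorff_pre (R : realType) (n k : nat) (delta : R)
    (A : set 'cV[R]_n) : \bar R :=
  ereal_inf [set (\sum_(i <oo) diam_pow k (E i))%E
            | E in [set E : nat -> set 'cV[R]_n |
                     (forall i, (ediam (E i) <= delta%:E)%E) /\
                     A `<=` \bigcup_i E i]].

(* Normalised so as to agree with k-dimensional volume on k-planes. *)
Definition hausdorff (R : realType) (n k : nat) (A : set 'cV[R]_n) : \bar R :=
  ((unit_ball_volume R k / 2 ^+ k)%:E *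
   ereal_sup [set hausdorff_pre k delta A
             | delta in [set delta : R | (0 < delta)%R]])%E.

Definition critical_set (R : realType) (d m : nat)
    (g : 'cV[R]_d -> 'cV[R]_m) : set 'cV[R]_d :=
  [set x | open_cube R d x /\ (\rank (jac g x) <= m - 1)%N].

Definition crit_inf (R : realType) (d m : nat) (f : 'cV[R]_d -> 'cV[R]_m)
    (eps : R) : \bar R :=
  ereal_inf [set hausdorff (d - 1) (critical_set g)
            | g in [set g : 'cV[R]_d -> 'cV[R]_m |
                     C1 g /\ (C1norm (g \- f)%R <= eps%:E)%E]].

(* Main.v *)
(** On a grid of mesh 1/n, blend the first order Taylor polynomials of [f] at
    the grid points with a C^1 tensor product partition of unity made of cubic
    polynomials on each cell. The result is C^1-close to [f] up to H n^(-alpha),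
    and its Jacobian agrees with that of [f] at the grid points; adding t x for
    a small generic t makes the leading m x m minor of the Jacobian nonzero at
    every grid point. Since n may be taken of order (H / eps)^(1 / alpha), it
    remains to bound the measure of the critical set by C n. On each of the n^d
    cells that minor is a nonzero polynomial of bounded degree, and
    its zero set is covered by O(N^(d-1)) cubes of side 1/(nN) for every N.

    This last fact is elementary: in a cell of the finer grid containing a zero,
    either the polynomial vanishes on a grid hyperplane bounding the cell, or
    its derivative in a coordinate direction vanishes in the cell. One concludes
    by induction on the dimension and on the degree. *)
Require Import Defs.
From mathcomp Require Import perm polyrcf lra ring zify.

Set Implicit Arguments.
Unset Strict Implicit.
Unset Printing Implicit Defensive.

Import Order.TTheory GRing.Theory Num.Theory.
Import numFieldNormedType.Exports.

Local Open Scope classical_set_scope.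
Local Open Scope ring_scope.

(** * Functions polynomial in each variable *)

(** The constant may depend on d and alpha only, so the degree of the pieces has to be bounded
    independently of f, m and the mesh; bounding m by d in the degree of the minor achieves this.
    Differentiating the partition of unity costs a factor n. It is recovered because the derivatives
    sum to zero and the Taylor polynomials match f up to order H n^(-1-alpha). The minor is nonzero
    on every cell because a corner of the cell is a grid point, and there the derivatives of the
    partition of unity vanish. The shift t affects neither the degree nor the number of cells, so it
    can be as small as desired. With n fixed, N grows to reach every scale of the Hausdorff measure:
    n^d cells, of order N^(d-1) cubes in each, of measure of order (nN)^(-(d-1)), add up to order n.
    The threshold for eps has two sources: if H > 0, it makes the unrounded value of n at least 1,
    so that rounding up costs a factor 2; if H = 0, the claimed bound is 0, and there the critical
    set is shown to be empty. *)

Definition upd (R : realType) (d : nat) (x : 'cV[R]_d) (i : 'I_d) (t : R) :=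
  \col_j (if j == i then t else x j 0).

Lemma upd_same (R : realType) d (x : 'cV[R]_d) i t : upd x i t i 0 = t.
Proof. by rewrite mxE eqxx. Qed.

Lemma upd_other (R : realType) d (x : 'cV[R]_d) i t j :
  j != i -> upd x i t j 0 = x j 0.
Proof. by rewrite mxE => /negbTE ->. Qed.

Lemma upd_id (R : realType) d (x : 'cV[R]_d) i : upd x i (x i 0) = x.
Proof. by apply/colP => j; rewrite mxE; case: eqP => [->|]. Qed.

Lemma upd_upd (R : realType) d (x : 'cV[R]_d) i s t :
  upd (upd x i s) i t = upd x i t.
Proof. by apply/colP => j; rewrite !mxE; case: eqP. Qed.

Lemma updC (R : realType) d (x : 'cV[R]_d) i j s t :
  i != j -> upd (upd x i s) j t = upd (upd x j t) i s.
Proof.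
move=> /negbTE ij; apply/colP => k; rewrite !mxE.
by case: (eqVneq k j) => [->|//]; rewrite eq_sym ij.
Qed.

(** Polynomiality is asked along each line parallel to an axis. The bound is on the size (degree
    plus one) and varies with the coordinate, since the induction lowers the degree in one
    coordinate at a time; a bound 0 forces the zero function. *)
Definition sepoly (R : realType) (d : nat) (e : 'I_d -> nat)
    (F : 'cV[R]_d -> R) : Prop :=
  forall i x, exists p : {poly R},
    (size p <= e i)%N /\ forall t, F (upd x i t) = p.[t].

Lemma sepoly_ext (R : realType) d (e : 'I_d -> nat) (F G : 'cV[R]_d -> R) :
  F =1 G -> sepoly e F -> sepoly e G.
Proof.
by move=> FG h i x; have [p [sp pE]] := h i x; exists p; split=> // t; rewrite -FG.
Qed.

Lemma sepoly_le (R : realType) d (e e' : 'I_d -> nat) (F : 'cV[R]_d -> R) :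
  (forall i, (e i <= e' i)%N) -> sepoly e F -> sepoly e' F.
Proof.
move=> le h i x; have [p [sp pE]] := h i x.
by exists p; split=> //; apply: leq_trans sp _.
Qed.

Lemma sepoly0 (R : realType) d (e : 'I_d -> nat) :
  sepoly e (fun _ : 'cV[R]_d => 0).
Proof. by move=> i x; exists 0; rewrite size_poly0; split=> // t; rewrite horner0. Qed.

Lemma sepoly_cst (R : realType) d (c : R) :
  sepoly (fun=> 1%N) (fun _ : 'cV[R]_d => c).
Proof.
by move=> i x; exists c%:P; rewrite size_polyC leq_b1; split=> // t; rewrite hornerC.
Qed.

Lemma sepolyD (R : realType) d (e : 'I_d -> nat) (F G : 'cV[R]_d -> R) :
  sepoly e F -> sepoly e G -> sepoly e (fun x => F x + G x).
Proof.
move=> hF hG i x; have [p [sp pE]] := hF i x; have [q [sq qE]] := hG i x.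
exists (p + q); split; last by move=> t; rewrite pE qE hornerD.
by apply: leq_trans (size_polyD _ _) _; rewrite geq_max sp.
Qed.

Lemma sepolyM (R : realType) d a b (F G : 'cV[R]_d -> R) :
  sepoly (fun=> a.+1) F -> sepoly (fun=> b.+1) G ->
  sepoly (fun=> (a + b).+1) (fun x => F x * G x).
Proof.
move=> hF hG i x; have [p [sp pE]] := hF i x; have [q [sq qE]] := hG i x.
exists (p * q); split; last by move=> t; rewrite pE qE hornerM.
apply: leq_trans (size_polyMleq _ _) _; lia.
Qed.

Lemma sepoly_sum (R : realType) d (e : 'I_d -> nat) I (r : seq I) (P : pred I)
    (F : I -> 'cV[R]_d -> R) :
  (forall i, P i -> sepoly e (F i)) ->
  sepoly e (fun x => \sum_(i <- r | P i) F i x).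
Proof.
move=> h; elim: r => [|i r IH].
  by refine (sepoly_ext _ (@sepoly0 R d e)) => x; rewrite big_nil.
have [Pi|nPi] := boolP (P i); last first.
  by refine (sepoly_ext _ IH) => x; rewrite big_cons (negbTE nPi).
by refine (sepoly_ext _ (sepolyD (h i Pi) IH)) => x; rewrite big_cons Pi.
Qed.

Lemma sepoly_prod (R : realType) d D (I : finType) (F : I -> 'cV[R]_d -> R) :
  (forall i, sepoly (fun=> D.+1) (F i)) ->
  sepoly (fun=> (#|I| * D).+1) (fun x => \prod_i F i x).
Proof.
move=> h; rewrite -sum1_card; apply: (@sepoly_ext _ _ _
  (fun x => \prod_(i <- index_enum I) F i x)) => //.
elim: (index_enum I) => [|i r IH].
  rewrite big_nil; refine (sepoly_ext _ (@sepoly_cst R d 1)) => x.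
  by rewrite big_nil.
rewrite big_cons mulnDl mul1n.
by refine (sepoly_ext _ (sepolyM (h i) IH)) => x; rewrite big_cons.
Qed.

Lemma sepoly_upd (R : realType) d (e : 'I_d -> nat) (F : 'cV[R]_d -> R) i c :
  sepoly e F -> sepoly e (fun x => F (upd x i c)).
Proof.
move=> h j x; have [->|ij] := eqVneq i j; last first.
  have [p [sp pE]] := h j (upd x i c).
  by exists p; split=> // t; rewrite updC 1?eq_sym.
have [p [sp pE]] := h j x.
exists (p.[c])%:P; split; last by move=> t; rewrite upd_upd hornerC pE.
(* The restriction is constant along [i]. A nonzero value [p.[c]] forces [p] to be nonzero, so the
   bound on the size survives even when it is 0. *)
rewrite size_polyC; case: (eqVneq p.[c] 0) => //= pc.
by rewrite (leq_trans _ sp)// lt0n size_poly_eq0; apply: contra_neq pc => ->; rewrite horner0.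
Qed.

(* Derivative along [i] of a function of degree [< K] in the i-th coordinate,
   by Lagrange interpolation at 0, ..., K-1: a linear combination of
   restrictions of [F] is visibly polynomial in the other coordinates. *)
Definition sdiff (R : realType) (d K : nat) (i : 'I_d) (F : 'cV[R]_d -> R)
    (x : 'cV[R]_d) : R :=
  \sum_(l < K) F (upd x i l%:R)
     * ((tnth (qpoly.lagrange K (fun j => j%:R)) l : {poly R})^`()).[x i 0].

Lemma sdiffE (R : realType) d K (i : 'I_d) (F : 'cV[R]_d -> R) x (p : {poly R}) :
  (0 < K)%N -> (size p <= K)%N -> (forall t, F (upd x i t) = p.[t]) ->
  forall t, sdiff K i F (upd x i t) = p^`().[t].
Proof.
move=> K0 sp pE t; rewrite [in RHS](@qpoly.lagrange_gen _ K (fun j => j%:R) K0 _ p sp).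
  rewrite raddf_sum horner_sum; apply: eq_bigr => l _.
  rewrite upd_upd upd_same pE.
  by rewrite -[RHS]/((_)^`().[t]) derivM derivC mul0r add0r hornerM hornerC.
by move=> a b /eqP; rewrite eqr_nat => /eqP.
Qed.

Lemma sepoly_sdiff (R : realType) d K (i : 'I_d) (F : 'cV[R]_d -> R) e :
  e i = K.+1 -> sepoly e F ->
  sepoly (fun j => if j == i then K else e j) (sdiff K.+1 i F).
Proof.
move=> eK hF j x; have [->|ji] := eqVneq j i.
  have [p [sp pE]] := hF i x; exists p^`(); split.
    have [->|p0] := eqVneq p 0; first by rewrite deriv0 size_poly0.
    by rewrite -ltnS (leq_trans (lt_size_deriv p0))// -eK.
  by apply: sdiffE => //; rewrite -eK.
(* Moving in direction [j] leaves [x i 0] fixed, so these coefficients are constant along the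
   line. *)
pose c (l : 'I_K.+1) : R :=
  ((tnth (qpoly.lagrange K.+1 (fun j => j%:R)) l : {poly R})^`()).[x i 0].
have hc l : sepoly e (fun y => c l * F (upd y i l%:R)).
  move=> k y; have [p [sp pE]] := sepoly_upd i l%:R hF k y.
  exists (c l *: p); split; last by move=> t; rewrite pE hornerZ.
  exact: leq_trans (size_scale_leq _ _) sp.
have [p [sp pE]] := sepoly_sum (index_enum _) (P := xpredT)
  (fun l _ => hc l) j x.
exists p; split=> // t; rewrite -pE; apply: eq_bigr => l _.
by rewrite upd_other 1?eq_sym// mulrC.
Qed.

(** The induction on the dimension keeps the ambient space and shrinks the set [S] of active
    coordinates. *)
Definition depends_on (R : realType) d (S : {set 'I_d}) (F : 'cV[R]_d -> R) :=
  forall x y : 'cV[R]_d, (forall j, j \in S -> x j 0 = y j 0) -> F x = F y.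

Lemma depends_on_sdiff (R : realType) d K (S : {set 'I_d}) i (F : 'cV[R]_d -> R) :
  i \in S -> depends_on S F -> depends_on S (sdiff K i F).
Proof.
move=> iS h x y xy; apply: eq_bigr => l _; rewrite xy//; congr (_ * _).
by apply: h => j jS; rewrite !mxE xy.
Qed.

Lemma depends_on_upd (R : realType) d (S : {set 'I_d}) i c (F : 'cV[R]_d -> R) :
  depends_on S F -> depends_on (S :\ i) (fun x => F (upd x i c)).
Proof.
move=> h x y xy; apply: h => j jS; rewrite !mxE; case: eqP => // /eqP ji.
by apply: xy; rewrite !inE ji.
Qed.

(** * Covering zero sets by grid points *)

(** Distances are counted in units of the mesh 1/N, and only in the active coordinates. The covering
    bounds then take the form of a fixed [rho] and a fixed multiple of a power of [N]. *)
Definition net (R : realType) d (S : {set 'I_d}) (Z : set 'cV[R]_d)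
    (N rho B : nat) : Prop :=
  exists L : seq 'cV[R]_d, (size L <= B)%N /\
    forall x, Z x -> exists2 y, y \in L &
      forall j, j \in S -> `|x j 0 - y j 0| <= rho%:R / N%:R.

Lemma net_le (R : realType) d (S : {set 'I_d}) (Z Z' : set 'cV[R]_d)
    N rho rho' B B' :
  Z' `<=` Z -> (rho <= rho')%N -> (B <= B')%N ->
  net S Z N rho B -> net S Z' N rho' B'.
Proof.
move=> ZZ rr BB [L [sL h]]; exists L; split; first exact: leq_trans sL BB.
move=> x /ZZ/h[y yL hy]; exists y => // j jS; apply: le_trans (hy j jS) _.
by rewrite ler_wpM2r ?invr_ge0// ler_nat.
Qed.

Lemma netU (R : realType) d (S : {set 'I_d}) (Z Z' : set 'cV[R]_d) N rho B B' :
  net S Z N rho B -> net S Z' N rho B' -> net S (Z `|` Z') N rho (B + B').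
Proof.
move=> [L [sL h]] [L' [sL' h']]; exists (L ++ L'); split.
  by rewrite size_cat leq_add.
by move=> x [/h|/h'] [y yL hy]; exists y => //; rewrite mem_cat yL ?orbT.
Qed.

Lemma net_bigU (R : realType) d (S : {set 'I_d}) (I : eqType) (s : seq I)
    (Z : I -> set 'cV[R]_d) N rho (B : I -> nat) :
  (forall p, p \in s -> net S (Z p) N rho (B p)) ->
  net S [set x | exists2 p, p \in s & Z p x] N rho (\sum_(p <- s) B p).
Proof.
elim: s => [|p s IH] h; first by exists [::]; split=> // x [].
rewrite big_cons.
have := netU (h p (mem_head _ _)) (IH (fun q qs => h q (@mem_behead _ (p :: s) q qs))).
apply: net_le => // x [q]; rewrite inE => /predU1P[->|qs]; first by left.
by right; exists q.
Qed.

Lemma net_thicken (R : realType) d (S : {set 'I_d}) (Z Z' : set 'cV[R]_d)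
    N rho B :
  (forall x, Z' x -> exists2 y, Z y &
     forall j, j \in S -> `|x j 0 - y j 0| <= 1 / N%:R) ->
  net S Z N rho B -> net S Z' N rho.+1 B.
Proof.
move=> near [L [sL h]]; exists L; split=> // x /near[y /h[z zL yz] xy].
exists z => // j jS; apply: le_trans (ler_distD (y j 0) _ _) _.
by rewrite -(add1n rho) natrD mulrDl lerD ?xy ?yz.
Qed.

Lemma grid_cell (R : realType) (N : nat) (t : R) : (0 < N)%N -> 0 <= t <= 1 ->
  exists2 p, (p < N)%N & p%:R / N%:R <= t <= p.+1%:R / N%:R.
Proof.
move=> N0 /andP[t0 t1]; have N0' : (0 : R) < N%:R by rewrite ltr0n.
have [->|tn1] := eqVneq t 1.
  (* The right endpoint of [0,1] is assigned to the last cell. *)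
  exists N.-1; rewrite ?prednK// divff ?gt_eqF// lexx andbT.
  by rewrite ler_pdivrMr// mul1r ler_nat leq_pred.
have /andP[h1 h2] := truncn_itv (mulr_ge0 t0 (ltW N0')).
exists (Num.trunc (t * N%:R)); last by rewrite ler_pdivrMr// h1 ler_pdivlMr// ltW.
by rewrite -(ltr_nat R) (le_lt_trans h1)// -[ltRHS]mul1r ltr_pM2r// lt_neqAle tn1.
Qed.

Lemma net_grid (R : realType) d (S : {set 'I_d}) N : (0 < N)%N ->
  net S [set x : 'cV[R]_d | forall j, j \in S -> 0 <= x j 0 <= 1] N 1
    (N ^ #|S|).
Proof.
case: N => // N _.
pose pt (k : {ffun 'I_d -> 'I_N.+1}) : 'cV[R]_d := \col_j ((k j)%:R / N.+1%:R).
(* Indices are frozen at [ord0] outside [S], so that the exponent in the count is [#|S|] and not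
   [d]. *)
exists [seq pt k | k in pffun_on ord0 (mem S) (mem 'I_N.+1)]; split.
  by rewrite size_map -cardE card_pffun_on card_ord.
move=> x hx.
have /choice[k kP] : forall j : 'I_d, exists p : 'I_N.+1,
    (j \in S -> p%:R / N.+1%:R <= x j 0 <= p.+1%:R / N.+1%:R) /\
    (j \notin S -> p = ord0).
  move=> j; have [jS|jS] := boolP (j \in S); last by exists ord0.
  have [p pN hp] := grid_cell (ltn0Sn N) (hx j jS).
  by exists (Ordinal pN).
exists (pt (finfun k)).
  apply: fintype.image_f; apply/pffun_onP; split=> //.
  apply/fintype.subsetP => j; rewrite inE ffunE; apply: contraNT => jS.
  by rewrite (kP j).2.
move=> j jS; rewrite mxE ffunE; have /andP[h1 h2] := (kP j).1 jS.
rewrite ger0_norm ?subr_ge0// lerBlDl -mulrDl.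
by rewrite -natrD addn1.
Qed.

Lemma net_face (R : realType) d (S : {set 'I_d}) i c (Z Z' : set 'cV[R]_d)
    N rho B :
  (forall x, Z' x -> x i 0 = c /\ Z x) ->
  net (S :\ i) Z N rho B -> net S Z' N rho B.
Proof.
move=> hZ [L [sL h]]; exists [seq upd y i c | y <- L].
rewrite size_map; split=> // x /hZ[xi /h[y yL hy]].
exists (upd y i c); first by apply/mapP; exists y.
move=> j jS; have [->|ji] := eqVneq j i; last by rewrite upd_other// hy// !inE ji.
by rewrite upd_same xi subrr normr0 divr_ge0.
Qed.

Definition box_zeros (R : realType) d (S : {set 'I_d}) (F : 'cV[R]_d -> R) :
    set 'cV[R]_d :=
  [set x : 'cV[R]_d | (forall j, j \in S -> 0 <= x j 0 <= 1) /\ F x = 0].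

(** A hyperplane on which [F] is not identically zero is covered by the hypothesis in one dimension
    less. One on which it vanishes identically costs N^n points, but there are at most [K] of these:
    each gives a root of the nonzero restriction of [F] to the line through [x0] in direction
    [i]. *)
Lemma net_zeros_hyperplanes (R : realType) d (S : {set 'I_d}) i K C rho n N
    (F : 'cV[R]_d -> R) e :
  (0 < N)%N -> i \in S -> #|S| = n.+1 -> (forall j, (e j <= K)%N) ->
  sepoly e F -> depends_on S F -> (exists x, F x != 0) ->
  (forall G : 'cV[R]_d -> R, sepoly e G -> depends_on (S :\ i) G ->
     (exists x, G x != 0) ->
     net (S :\ i) (box_zeros (S :\ i) G) N rho (C * N ^ n.-1)) ->
  net S [set x | box_zeros S F x /\
                 exists2 p, (p <= N)%N & x i 0 = p%:R / N%:R]
    N (rho + 1) (C * N ^ n.-1 * N.+1 + K * N ^ n).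
Proof.
move=> N0 iS cS eK hF dF [x0 Fx0] IH.
have cSi : #|S :\ i| = n by have := cardsD1 i S; rewrite iS cS add1n => -[<-].
pose c (p : nat) : R := p%:R / N%:R.
pose bad p := `[< forall x, F (upd x i (c p)) = 0 >].
pose B p := (C * N ^ n.-1 + bad p * N ^ n)%N.
have hp p : p \in iota 0 N.+1 ->
    net S [set x | box_zeros S F x /\ x i 0 = c p] N (rho + 1) (B p).
  move=> _; rewrite /B; case: (boolP (bad p)) => [bp|/asboolPn bp].
    apply: (@net_le _ _ _ [set x | box_zeros S F x /\ x i 0 = c p] _ N 1 _ (N ^ n)).
    - by [].
    - by rewrite addn1.
    - by rewrite mul1n leq_addl.
    rewrite -cSi; apply: net_face (net_grid R (S :\ i) N0) => x [[xb _] xi].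
    by split=> [|j]; [exact: xi|rewrite !inE => /andP[_ /xb]].
  pose G x := F (upd x i (c p)).
  have hG : net (S :\ i) (box_zeros (S :\ i) G) N rho (C * N ^ n.-1).
    apply: IH; [exact: sepoly_upd|exact: depends_on_upd|].
    by have /existsNP[x /eqP] := bp; exists x.
  rewrite mul0n addn0; apply: (@net_face _ _ _ i (c p) (box_zeros (S :\ i) G)).
    move=> x [[xb Fx] xi]; split=> //; split; last by rewrite /G -xi upd_id.
    by move=> j; rewrite !inE => /andP[_ /xb].
  by apply: net_le hG => //; exact: leq_addr.
apply: net_le (net_bigU hp) => //.
  by move=> x [xz [p pN xp]]; exists p; rewrite ?mem_iota.
rewrite big_split big_const_seq count_predT iter_addn_0 size_iota leq_add2l.
rewrite -big_distrl leq_mul2r; apply/orP; right.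
have [q [sq qE]] := hF i x0.
have q0 : q != 0.
  by apply: contraNneq Fx0 => q0; rewrite -(upd_id x0 i) qE q0 horner0.
have -> : (\sum_(p <- iota 0 N.+1) bad p)%N = size [seq c p | p <- iota 0 N.+1 & bad p].
  by rewrite size_map size_filter -sumn_count sumnE big_map.
apply: leq_trans (eK i); apply: leq_trans sq; apply: ltnW.
apply: max_poly_roots q0 _ _.
  apply/allP => y /mapP[p]; rewrite mem_filter => /andP[/asboolP bp _] ->.
  by rewrite rootE -qE bp.
rewrite map_inj_uniq ?filter_uniq ?iota_uniq// => a b /(congr1 ( *%R^~ N%:R)).
by rewrite !divfK ?pnatr_eq0 -?lt0n// => /eqP; rewrite eqr_nat => /eqP.
Qed.

Lemma poly_root_list (R : realType) (p : {poly R}) : p != 0 ->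
  exists L : seq R, (size L <= size p)%N /\ forall x, root p x -> x \in L.
Proof.
have [n] := ubnP (size p); elim: n p => // n IH p; rewrite ltnS => sp p0.
have [[a pa]|noroot] := pselect (exists a, root p a); last first.
  by exists [::]; split=> // x px; case: noroot; exists x.
have /factor_theorem[q pE] := pa.
have q0 : q != 0 by apply: contraNneq p0 => q0; rewrite pE q0 mul0r.
have sq : size p = (size q).+1.
  by rewrite pE size_Mmonic ?monicXsubC// size_XsubC addn2.
have [|L [sL hL]] := IH q _ q0; first by rewrite -sq.
exists (a :: L); split; first by rewrite /= sq.
move=> x; rewrite pE rootM root_XsubC inE => /orP[/hL ->|->//].
by rewrite orbT.
Qed.

(** The mean value theorem on both sides of the zero gives slopes of opposite signs, and the
    derivative vanishes between them. The first conclusion provides the nonvanishing that the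
    induction on the degree requires of the derivative. *)
Lemma poly_bump (R : realType) (p : {poly R}) a x b : a <= x <= b ->
  p.[x] = 0 -> 0 < p.[a] * p.[b] ->
  (exists z, p^`().[z] != 0) /\ exists2 c, a <= c <= b & p^`().[c] = 0.
Proof.
move=> /andP[ax xb] px pab.
have pa0 : p.[a] != 0 by apply: contraTneq pab => ->; rewrite mul0r ltxx.
have pb0 : p.[b] != 0 by apply: contraTneq pab => ->; rewrite mulr0 ltxx.
have {}ax : a < x.
  by rewrite lt_neqAle ax andbT; apply: contraNneq pa0 => ->; rewrite px.
have {}xb : x < b.
  by rewrite lt_neqAle xb andbT; apply: contraNneq pb0 => <-; rewrite px.
have [c1 c1i h1] := poly_mvt p ax.
have [c2 c2i h2] := poly_mvt p xb.
rewrite px sub0r in h1; rewrite px subr0 in h2.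
have neg : p^`().[c1] * p^`().[c2] < 0.
  have H : p^`().[c1] * p^`().[c2] * ((x - a) * (b - x)) < 0.
    by rewrite mulrACA -h1 -h2 mulNr oppr_lt0.
  by move: H; rewrite pmulr_llt0// mulr_gt0// subr_gt0.
have c12 : c1 <= c2 by rewrite (le_trans (y := x))// ltW// (itvP c1i, itvP c2i).
split.
  by exists c1; apply: contraTneq neg => ->; rewrite mul0r ltxx.
have [c ci /eqP rc] := poly_ivtoo c12 neg.
exists c => //; apply/andP; split.
  by apply: (le_trans (y := c1)); rewrite ?(itvP ci)// ltW// (itvP c1i).
by apply: (le_trans (y := c2)); rewrite ?(itvP ci)// ltW// (itvP c2i).
Qed.

Lemma sepoly_ivt (R : realType) d (e : 'I_d -> nat) (F : 'cV[R]_d -> R) i x a b :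
  sepoly e F -> a <= b -> F (upd x i a) * F (upd x i b) <= 0 ->
  exists2 c, a <= c <= b & F (upd x i c) = 0.
Proof.
move=> hF ab; have [p [_ pE]] := hF i x; rewrite !pE => h.
have [c ci /eqP rc] := polyrcf.poly_ivt ab h.
by exists c; rewrite ?pE// !(itvP ci).
Qed.

Lemma cell_dist (R : realType) (a b : R) (N p : nat) :
  p%:R / N%:R <= a <= p.+1%:R / N%:R -> p%:R / N%:R <= b <= p.+1%:R / N%:R ->
  `|a - b| <= 1 / N%:R.
Proof.
by rewrite -(addn1 p) natrD mulrDl => /andP[a1 a2] /andP[b1 b2];
   rewrite ler_norml; apply/andP; split; lra.
Qed.

(* The boundary of a cell is connected in dimension at least two: either [F]
   vanishes on a path made of three boundary segments joining the two ends of
   the line through [x] in direction [i], or it has the same sign at both ends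
   and its derivative vanishes on that line. *)
Lemma zero_moves_to_boundary (R : realType) d (S : {set 'I_d}) i j K N
    (e : 'I_d -> nat) (F : 'cV[R]_d -> R) x :
  (0 < N)%N -> i \in S -> j \in S -> i != j -> e i = K.+1 -> sepoly e F ->
  box_zeros S F x ->
  exists2 y : 'cV[R]_d,
    [\/ box_zeros S F y /\ exists2 p, (p <= N)%N & y i 0 = p%:R / N%:R,
        box_zeros S F y /\ exists2 p, (p <= N)%N & y j 0 = p%:R / N%:R |
        box_zeros S (sdiff K.+1 i F) y /\ exists z, sdiff K.+1 i F z != 0] &
    forall k, k \in S -> `|x k 0 - y k 0| <= 1 / N%:R.
Proof.
move=> N0 iS jS ij eK hF [xb Fx].
have N0' : (0 : R) < N%:R by rewrite ltr0n.
have [p pN hp] := grid_cell N0 (xb i iS).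
have [q qN hq] := grid_cell N0 (xb j jS).
set a := p%:R / N%:R in hp *; set b := p.+1%:R / N%:R in hp *.
set c := q%:R / N%:R in hq *.
have cell01 r t : (r < N)%N -> r%:R / N%:R <= t <= r.+1%:R / N%:R ->
    0 <= t <= (1 : R).
  move=> rN /andP[t0 t1]; rewrite (le_trans _ t0) ?divr_ge0//=.
  by rewrite (le_trans t1)// ler_pdivrMr// mul1r ler_nat.
(* Coordinates [i] and [j] may move freely inside their cells. *)
have grid (u v : R) : a <= u <= b -> c <= v <= q.+1%:R / N%:R ->
    let y := upd (upd x i u) j v in
    (forall k, k \in S -> 0 <= y k 0 <= 1) /\
    (forall k, k \in S -> `|x k 0 - y k 0| <= 1 / N%:R).
  move=> hu hv y; split=> k kS; rewrite /y !mxE.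
    case: eqP => _; first exact: cell01 qN hv.
    by case: eqP => _; [exact: cell01 pN hu|exact: xb].
  case: eqP => [->|_]; first exact: cell_dist hq hv.
  case: eqP => [->|_]; first exact: cell_dist hp hu.
  by rewrite subrr normr0 divr_ge0.
have leS r : r%:R / N%:R <= r.+1%:R / N%:R :> R.
  by rewrite ler_pM2r ?invr_gt0// ler_nat.
have ha : a <= a <= b by rewrite lexx leS.
have hb : a <= b <= b by rewrite lexx leS.
have hc : c <= c <= q.+1%:R / N%:R by rewrite lexx leS.
have cxj : c <= x j 0 by case/andP: hq.
have aE u v : upd (upd x i u) j v i 0 = u by rewrite upd_other// upd_same.
have side u r : a <= u <= b -> (r <= N)%N -> u = r%:R / N%:R ->
    F (upd (upd x i u) j c) * F (upd (upd x i u) j (x j 0)) <= 0 ->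
  exists2 y : 'cV[R]_d,
    box_zeros S F y /\ exists2 p, (p <= N)%N & y i 0 = p%:R / N%:R &
    forall k, k \in S -> `|x k 0 - y k 0| <= 1 / N%:R.
  move=> hu rN uE /(sepoly_ivt hF cxj)[v hv Fv].
  have hv' : c <= v <= q.+1%:R / N%:R.
    by case/andP: hv => -> /le_trans; apply; case/andP: hq.
  have [y1 y2] := grid u v hu hv'.
  by exists (upd (upd x i u) j v) => //; split=> //; exists r; rewrite ?aE.
have [h1|h1] := lerP (F (upd (upd x i a) j c) * F (upd (upd x i a) j (x j 0))) 0.
  have [y y1 y2] := side a p ha (ltnW pN) erefl h1.
  by exists y => //; constructor 1.
have [h2|h2] := lerP (F (upd (upd x i b) j c) * F (upd (upd x i b) j (x j 0))) 0.
  have [y y1 y2] := side b p.+1 hb pN erefl h2.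
  by exists y => //; constructor 1.
have [h3|h3] := lerP (F (upd (upd x i a) j c) * F (upd (upd x i b) j c)) 0.
  rewrite !(updC _ _ _ ij) in h3.
  have [|u hu Fu] := sepoly_ivt hF _ h3; first exact: leS.
  have [y1 y2] := grid u c hu hc; rewrite updC// in y1 y2.
  exists (upd (upd x j c) i u) => //; constructor 2; split=> //; exists q.
    exact: ltnW.
  by rewrite upd_other 1?eq_sym// upd_same.
have updj u : upd (upd x i u) j (x j 0) = upd x i u.
  by rewrite updC// upd_id.
rewrite !updj in h1 h2.
have [r [sr rE]] := hF i x.
rewrite eK in sr.
(* Multiplied by the positive product of [h3], it regroups into the product of the quantities in
   [h1] and [h2]. *)
have h4 : 0 < r.[a] * r.[b].
  rewrite -!rE -(pmulr_rgt0 _ h3).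
  rewrite [X in 0 < X](_ : _ = (F (upd (upd x i a) j c) * F (upd x i a)) *
    (F (upd (upd x i b) j c) * F (upd x i b))); last by ring.
  exact: mulr_gt0.
have rx : r.[x i 0] = 0 by rewrite -rE upd_id.
have [[t rt] [u hu ru]] := poly_bump hp rx h4.
exists (upd x i u).
  constructor 3; split; last first.
    by exists (upd x i t); rewrite (sdiffE _ _ rE).
  split; last by rewrite (sdiffE _ _ rE).
  by have [+ _] := grid u (x j 0) hu hq; rewrite updj.
by have [_ +] := grid u (x j 0) hu hq; rewrite updj.
Qed.

(** The outer induction is on the number of active coordinates, the inner one on a bound [K0] for
    the size in a chosen direction [i]. Grid hyperplanes fall to the outer hypothesis and the
    derivative along [i] to the inner one, while [K] keeps bounding the size in every direction. *)
Lemma net_zeros (R : realType) d (n K : nat) : exists C rho : nat,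
  forall (S : {set 'I_d}) (F : 'cV[R]_d -> R) (e : 'I_d -> nat) (N : nat),
    #|S| = n.+1 -> (forall i, (e i <= K)%N) -> sepoly e F -> depends_on S F ->
    (exists x, F x != 0) -> (0 < N)%N ->
    net S (box_zeros S F) N rho (C * N ^ n).
Proof.
elim: n => [|n [C [rho IH]]].
  exists K, 0%N => S F e N /eqP/cards1P[i ->] eK hF dF [x Fx] N0.
  have [p [sp pE]] := hF i x.
  have p0 : p != 0.
    by apply: contraNneq Fx => p0; rewrite -(upd_id x i) pE p0 horner0.
  have [L [sL hL]] := poly_root_list p0.
  exists [seq upd x i t | t <- L]; split.
    by rewrite size_map expn0 muln1 (leq_trans sL)// (leq_trans sp).
  move=> y [_ Fy]; exists (upd x i (y i 0)).
    apply/map_f/hL; rewrite rootE -pE -[X in _ == X]Fy; apply/eqP/dF => j.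
    by rewrite inE => /eqP ->; rewrite upd_same.
  by move=> j; rewrite inE => /eqP ->; rewrite upd_same subrr normr0 divr_ge0.
suff inner K0 : exists C' rho' : nat,
  forall (S : {set 'I_d}) (F : 'cV[R]_d -> R) (e : 'I_d -> nat) (N : nat) i,
    i \in S -> (e i <= K0)%N ->
    #|S| = n.+2 -> (forall i, (e i <= K)%N) -> sepoly e F -> depends_on S F ->
    (exists x, F x != 0) -> (0 < N)%N ->
    net S (box_zeros S F) N rho' (C' * N ^ n.+1).
  have [C' [rho' h]] := inner K; exists C', rho' => S F e N cS eK.
  have [i iS] : exists i, i \in S by apply/card_gt0P; rewrite cS.
  exact: (h S F e N i iS).
elim: K0 => [|K0 [C' [rho' IH0]]].
  exists 0%N, 0%N => S F e N i iS ei0 _ _ hF _ [x Fx].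
  have [p [sp pE]] := hF i x; exfalso; move/eqP: Fx; apply.
  rewrite -(upd_id x i) pE.
  by have /eqP -> : p == 0; rewrite ?horner0// -size_poly_eq0 -leqn0 (leq_trans sp).
(* Two families of hyperplanes cost [2 * C + K] each, where N + 1 <= 2 N gives the coefficient of
   [C]; the derivative adds [C']. The successor in the radius pays for moving the zero within its
   cell. *)
exists (2 * (2 * C + K) + C')%N, (rho + 1 + rho').+1 => S F e N i iS.
rewrite leq_eqVlt ltnS => /predU1P[eiK|eiK] cS eK hF dF F0 N0; last first.
  apply: net_le (IH0 S F e N i iS eiK cS eK hF dF F0 N0) => //.
    by rewrite ltnW// ltnS leq_addl.
  by rewrite leq_mul2r leq_addl orbT.
have [j /andP[ji jS]] : exists j, (j != i) && (j \in S).
  have : (0 < #|S :\ i|)%N by have := cardsD1 i S; rewrite iS cS add1n => -[<-].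
  by case/card_gt0P => j; rewrite !inE; exists j.
have faces k : k \in S -> net S [set x | box_zeros S F x /\
    exists2 p, (p <= N)%N & x k 0 = p%:R / N%:R] N (rho + 1)
    ((2 * C + K) * N ^ n.+1).
  move=> kS; have cSk : #|S :\ k| = n.+1.
    by have := cardsD1 k S; rewrite kS cS add1n => -[<-].
  have := net_zeros_hyperplanes N0 kS cS eK hF dF F0
    (fun G hG dG G0 => IH _ G e N cSk eK hG dG G0 N0).
  apply: net_le => //=; rewrite mulnDl leq_add2r expnS.
  by rewrite mulnAC mulnA leq_mul2r; apply/orP; right; nia.
set D := sdiff K0.+1 i F.
have deriv : net S [set x | box_zeros S D x /\ exists z, D z != 0] N rho'
    (C' * N ^ n.+1).
  have [D0|D0] := pselect (exists z, D z != 0); last first.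
    by exists [::]; split=> // x [_].
  apply: (@net_le _ _ _ (box_zeros S D) _ N rho' _ (C' * N ^ n.+1)) => //.
    by move=> x [].
  apply: (IH0 S D (fun k => if k == i then K0 else e k) N i iS) => //.
  - by rewrite eqxx.
  - move=> k; case: ifP => _ //; apply: leq_trans (eK i); rewrite eiK; lia.
  - exact: sepoly_sdiff.
  - exact: depends_on_sdiff.
pose Z := ([set x | box_zeros S F x /\
    exists2 p, (p <= N)%N & x i 0 = p%:R / N%:R] `|` [set x | box_zeros S F x /\
    exists2 p, (p <= N)%N & x j 0 = p%:R / N%:R]) `|`
    [set x | box_zeros S D x /\ exists z, D z != 0].
have hZ : net S Z N (rho + 1 + rho') ((2 * (2 * C + K) + C') * N ^ n.+1).
  rewrite mulnDl -mulnA mul2n -addnn; apply: netU.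
    apply: netU; [apply: net_le (faces i iS)|apply: net_le (faces j jS)] => //;
      exact: leq_addr.
  by apply: net_le deriv => //; exact: leq_addl.
apply: net_thicken hZ => x xz.
have ij : i != j by rewrite eq_sym.
have [y hy yx] := zero_moves_to_boundary N0 iS jS ij eiK hF xz.
by exists y => //; case: hy; [left; left|left; right|right].
Qed.

(** * Hausdorff measure *)

Lemma enorm_ge0 (R : realType) n (v : 'cV[R]_n) : 0 <= enorm v.
Proof. exact: sqrtr_ge0. Qed.

Lemma enorm_le_sum (R : realType) n (v : 'cV[R]_n) :
  enorm v <= \sum_i `|v i 0|.
Proof.
have S0 : 0 <= \sum_i `|v i 0| by apply: sumr_ge0.
rewrite -[leRHS]ger0_norm// -sqrtr_sqr ler_sqrt ?sqr_ge0//.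
rewrite expr2 mulr_suml; apply: ler_sum => i _.
rewrite -real_normK ?num_real// expr2.
by rewrite ler_wpM2l// (bigD1 i)//= lerDl sumr_ge0.
Qed.

Lemma coord_le_enorm (R : realType) n (v : 'cV[R]_n) i : `|v i 0| <= enorm v.
Proof.
rewrite -sqrtr_sqr ler_sqrt ?sumr_ge0// => [|j _]; last exact: sqr_ge0.
by rewrite (bigD1 i)//= lerDl sumr_ge0// => j _; exact: sqr_ge0.
Qed.

Lemma enorm_le_max (R : realType) n (v : 'cV[R]_n) r :
  (forall i, `|v i 0| <= r) -> enorm v <= n%:R * r.
Proof.
move=> h; have -> : n%:R * r = \sum_(i < n) r.
  by rewrite sumr_const card_ord mulr_natl.
by apply: le_trans (enorm_le_sum v) _; exact: ler_sum.
Qed.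

Lemma unit_ball_volume_ge0 (R : realType) k : 0 <= unit_ball_volume R k.
Proof.
have [n] := ubnP k; elim: n k => // n IH [|[|k]] //= kn.
by rewrite mulr_ge0 ?IH ?divr_ge0 ?mulr_ge0 ?pi_ge0//; lia.
Qed.

Lemma diam_pow_ge0 (R : realType) n k (E : set 'cV[R]_n) :
  (0 <= diam_pow k E)%E.
Proof.
rewrite /diam_pow; case: eqP => // /eqP/set0P[x Ex]; rewrite expe_ge0//.
apply: ereal_sup_ubound; exists (x, x) => //=.
by rewrite subrr /enorm big1 ?sqrtr0// => i _; rewrite mxE expr0n.
Qed.

Lemma expe_le (R : realType) (x y : \bar R) k :
  (0 <= x)%E -> (x <= y)%E -> (x ^+ k <= y ^+ k)%E.
Proof.
move=> x0 xy; elim: k => [|k IH]; first by rewrite !expe0.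
by rewrite !expeS lee_pmul// expe_ge0.
Qed.

(** Each listed point stands for the cube of half-side [r] around it, whose diameter is at most d *
    2r. The same [M] at every scale bounds the supremum over the scales. *)
Lemma hausdorff_le (R : realType) d k (A : set 'cV[R]_d) (M : R) :
  (forall delta : R, 0 < delta -> exists (L : seq 'cV[R]_d) (r : R),
     [/\ 0 <= r, d%:R * (2 * r) <= delta,
         forall x, A x -> exists2 y, y \in L & forall j, `|x j 0 - y j 0| <= r
       & (size L)%:R * (d%:R * (2 * r)) ^+ k <= M]) ->
  (hausdorff k A <= (unit_ball_volume R k / 2 ^+ k * M)%:E)%E.
Proof.
move=> H; rewrite /hausdorff [leRHS]EFinM; apply: lee_wpmul2l.
  by rewrite lee_fin divr_ge0// unit_ball_volume_ge0.
apply: ge_ereal_sup => _ [delta /= d0 <-].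
have [L [r [r0 rd cov sz]]] := H _ d0.
(* Past the end of the list the sets are empty, hence free even when [k] is 0. *)
pose E (i : nat) : set 'cV[R]_d :=
  [set x | (i < size L)%N /\ forall j, `|x j 0 - nth 0 L i j 0| <= r].
have dE i : (ediam (E i) <= (d%:R * (2 * r))%:E)%E.
  apply: ge_ereal_sup => _ [[x y] /= [[_ hx] [_ hy]] <-]; rewrite lee_fin.
  apply: enorm_le_max => j; rewrite !mxE mulr2n mulrDl mul1r.
  by rewrite (le_trans (ler_distD (nth 0 L i j 0) _ _))// lerD// distrC.
have dp i : (diam_pow k (E i) <= ((i < size L)%:R * (d%:R * (2 * r)) ^+ k)%:E)%E.
  rewrite /diam_pow; case: eqP => [_|/eqP E0].
    by rewrite lee_fin mulr_ge0// exprn_ge0// !mulr_ge0.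
  have iL : (i < size L)%N by case/set0P: E0 => x [].
  rewrite iL mul1r EFin_expe; apply: expe_le => //.
  (* Nonnegativity of the diameter is read off from [diam_pow] with exponent 1. *)
  by have := diam_pow_ge0 1 (E i); rewrite /diam_pow (negbTE E0) expeS expe0 mule1.
apply: (@le_trans _ _ (\sum_(i <oo) diam_pow k (E i))%E).
  apply: ereal_inf_lbound; exists E => //; split=> [i|x /cov[y yL hy]].
    by apply: le_trans (dE i) _; rewrite lee_fin.
  exists (index y L) => //; split; first by rewrite index_mem.
  by rewrite nth_index.
apply: lime_le; first by apply: is_cvg_nneseries => i _ _; exact: diam_pow_ge0.
apply: nearW => n.
apply: le_trans (lee_sum _ (fun i _ => dp i)) _.
rewrite sumEFin lee_fin; apply: le_trans sz.
rewrite -mulr_suml ler_wpM2r ?exprn_ge0 ?mulr_ge0//.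
rewrite -natr_sum ler_nat; suff -> : (\sum_(0 <= i < n) (i < size L))%N = minn n (size L).
  exact: geq_minr.
by elim: n => [|n IH]; rewrite ?big_nil ?min0n// big_nat_recr//= IH; lia.
Qed.

(** * Zero sets cell by cell on the grid of mesh 1/n *)

Definition in_cell (R : realType) d n (l : {ffun 'I_d -> 'I_n})
    (x : 'cV[R]_d) : Prop :=
  forall j, (l j)%:R / n%:R <= x j 0 <= (l j).+1%:R / n%:R.

Definition cell_coord (R : realType) d n (l : {ffun 'I_d -> 'I_n})
    (x : 'cV[R]_d) : 'cV[R]_d :=
  \col_j (n%:R * x j 0 - (l j)%:R).

Lemma exists_cell (R : realType) d n (x : 'cV[R]_d) :
  (0 < n)%N -> cube R d x -> exists l : {ffun 'I_d -> 'I_n}, in_cell l x.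
Proof.
move=> n0 hx; have /choice[k kP] : forall j : 'I_d, exists p : 'I_n,
    p%:R / n%:R <= x j 0 <= p.+1%:R / n%:R.
  move=> j; have [p pn hp] := grid_cell n0 (hx j).
  by exists (Ordinal pn).
by exists (finfun k) => j; rewrite ffunE.
Qed.

Lemma cell_coord_cube (R : realType) d n (l : {ffun 'I_d -> 'I_n})
    (x : 'cV[R]_d) : (0 < n)%N -> in_cell l x -> cube R d (cell_coord l x).
Proof.
move=> n0 lx j; rewrite mxE; have /andP[] := lx j.
rewrite ler_pdivrMr ?ltr0n// ler_pdivlMr ?ltr0n// -natr1 [x j 0 * _]mulrC.
by move=> ? ?; apply/andP; split; lra.
Qed.

(** There are n^d cells, at most c N^(d-1) cubes in each, and the cubes have diameter at most 2 d
    rho / (n N). In the total the powers of N cancel and a single factor n survives. *)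
Lemma hausdorff_cells (R : realType) d K : (0 < d)%N ->
  exists C : R, 0 <= C /\
    forall n (A : set 'cV[R]_d) (F : {ffun 'I_d -> 'I_n} -> 'cV[R]_d -> R),
      (0 < n)%N -> (forall l, sepoly (fun=> K) (F l)) ->
      (forall l, exists x, F l x != 0) ->
      (forall x, A x -> cube R d x /\
         forall l, in_cell l x -> F l (cell_coord l x) = 0) ->
      (hausdorff (d - 1) A <= (C * n%:R)%:E)%E.
Proof.
move=> d0; have [c [rho H]] := net_zeros R d (d - 1) K.
exists (unit_ball_volume R (d - 1) / 2 ^+ (d - 1) *
  (c%:R * (2 * d%:R * rho%:R) ^+ (d - 1))); split.
  by rewrite mulr_ge0 ?divr_ge0 ?unit_ball_volume_ge0// mulr_ge0// exprn_ge0// !mulr_ge0.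
move=> n A F n0 hF F0 hA; rewrite -mulrA; apply: hausdorff_le => delta delta0.
(* This makes 2 d rho / N at most [delta]; the further division by n >= 1 preserves the bound. *)
pose N := (Num.trunc (2 * d%:R * rho%:R / delta)).+1.
have N0 : (0 : R) < N%:R by rewrite ltr0n.
have n0' : (0 : R) < n%:R by rewrite ltr0n.
have /choice[L LP] : forall l : {ffun 'I_d -> 'I_n}, exists L : seq 'cV[R]_d,
    (size L <= c * N ^ (d - 1))%N /\
    forall x, cube R d x -> F l x = 0 -> exists2 y, y \in L &
      forall j, `|x j 0 - y j 0| <= rho%:R / N%:R.
  move=> l; have [|||//|||L [sL hL]] := H [set: 'I_d]%SET (F l) (fun=> K) N.
  - by rewrite cardsT card_ord subn1 prednK.
  - by [].
  - exact: hF.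
  - by move=> x y xy; congr F; apply/colP => j; rewrite xy ?inE.
  - exact: F0.
  - by [].
  exists L; split=> // x xc Fx; have [|y yL hy] := hL x; first by split.
  by exists y => // j; apply: hy; rewrite inE.
pose pt (l : {ffun 'I_d -> 'I_n}) (y : 'cV[R]_d) : 'cV[R]_d :=
  \col_j ((y j 0 + (l j)%:R) / n%:R).
exists [seq pt l y | l <- enum {: {ffun 'I_d -> 'I_n}}, y <- L l].
exists (rho%:R / (N%:R * n%:R)); split.
- by rewrite divr_ge0 ?mulr_ge0.
- rewrite !mulrA ler_pdivrMr ?mulr_gt0// [d%:R * 2]mulrC.
  have : 2 * d%:R * rho%:R / delta <= N%:R by rewrite ltW// truncnS_gt.
  rewrite ler_pdivrMr// => h; apply: le_trans h _.
  have h1 : (N%:R : R) <= N%:R * n%:R by rewrite ler_peMr ?ler1n// ltW.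
  by rewrite mulrC ler_pM2l.
- move=> x /hA[xc hx]; have [l lx] := exists_cell n0 xc.
  have [y yL hy] := (LP l).2 _ (cell_coord_cube n0 lx) (hx l lx).
  exists (pt l y); first by apply: allpairs_f_dep; rewrite ?mem_enum.
  move=> j; move: (hy j); rewrite !mxE.
  have -> : x j 0 - (y j 0 + (l j)%:R) / n%:R =
      (n%:R * x j 0 - (l j)%:R - y j 0) / n%:R.
    by field; rewrite gt_eqF.
  have i0 : 0 <= (n%:R : R)^-1 by rewrite invr_ge0 ltW.
  rewrite normrM (ger0_norm i0) => h.
  by rewrite invfM [leRHS]mulrA; apply: ler_wpM2r.
rewrite size_allpairs_dep.
have sz : (sumn [seq size (L l) | l <- enum {: {ffun 'I_d -> 'I_n}}] <=
    n ^ d * (c * N ^ (d - 1)))%N.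
  have -> : (n ^ d)%N = size (enum {: {ffun 'I_d -> 'I_n}}).
    by rewrite -cardE card_ffun !card_ord.
  elim: (enum _) => //= l s IH; rewrite mulSn leq_add//; exact: (LP l).1.
apply: le_trans (_ : (n ^ d * (c * N ^ (d - 1)))%:R *
   (d%:R * (2 * (rho%:R / (N%:R * n%:R)))) ^+ (d - 1) <= _).
  by rewrite ler_wpM2r ?ler_nat// exprn_ge0 ?mulr_ge0// invr_ge0 mulr_ge0.
have -> : d%:R * (2 * (rho%:R / (N%:R * n%:R))) =
   (2 * d%:R * rho%:R) * (N%:R^-1 * n%:R^-1) :> R.
  by rewrite invfM; ring.
rewrite !natrM !natrX !exprMn !exprVn -{1}(subnK d0) addn1 exprS.
rewrite le_eqVlt; apply/orP; left; apply/eqP; field.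
by rewrite !expf_neq0 ?gt_eqF.
Qed.

(** * Jacobians *)

Definition l1 (R : realType) d (v : 'cV[R]_d) : R := \sum_j `|v j 0|.

Lemma l1_ge0 (R : realType) d (v : 'cV[R]_d) : 0 <= l1 v.
Proof. exact: sumr_ge0. Qed.

Lemma coord_le_l1 (R : realType) d (v : 'cV[R]_d) j : `|v j 0| <= l1 v.
Proof. by rewrite /l1 (bigD1 j)//= lerDl sumr_ge0. Qed.

Lemma l1_le (R : realType) d (v : 'cV[R]_d) r :
  (forall j, `|v j 0| <= r) -> l1 v <= d%:R * r.
Proof.
move=> h; have -> : d%:R * r = \sum_(i < d) r.
  by rewrite sumr_const card_ord mulr_natl.
exact: ler_sum.
Qed.

Lemma near_within_cube (R : realType) d (x : 'cV[R]_d) (P : 'cV[R]_d -> Prop) :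
  (\forall y \near within (cube R d) (nbhs x), P y) <->
  exists2 delta : R, 0 < delta & forall y, cube R d y ->
    (forall j, `|y j 0 - x j 0| < delta) -> P y.
Proof.
split.
  move=> /nbhs_ballP[e /= e0 h]; exists e => // y yc yx; apply: (h y) => //.
  split=> // i j; rewrite (ord1 j) /ball /= distrC; exact: yx.
move=> [e e0 h]; apply/nbhs_ballP; exists e => //= y [_ yx] yc; apply: h => // j.
by rewrite distrC; exact: yx.
Qed.

(** By equivalence of norms, closeness can be measured by the largest coordinate and the error by
    [l1]. Without quotients, every later estimate becomes a sum over coordinates. *)
Lemma has_jacobianP (R : realType) d m (f : 'cV[R]_d -> 'cV[R]_m) x
    (A : 'M[R]_(m, d)) :
  has_jacobian f x A <->
  forall eps : R, 0 < eps -> exists2 delta : R, 0 < delta &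
    forall y, cube R d y -> (forall j, `|y j 0 - x j 0| < delta) ->
    forall i, `|f y i 0 - f x i 0 - \sum_j A i j * (y j 0 - x j 0)| <=
      eps * l1 (y - x).
Proof.
have E y i : (f y - f x - A *m (y - x)) i 0 =
    f y i 0 - f x i 0 - \sum_j A i j * (y j 0 - x j 0).
  by rewrite !mxE; congr (_ - _); apply: eq_bigr => j _; rewrite !mxE.
rewrite /has_jacobian; split.
  move=> /cvgr0Pnorm_le h eps eps0.
  have /near_within_cube[delta d0 hd] : \forall y \near within (cube R d) (nbhs x),
      y != x -> `|enorm (f y - f x - A *m (y - x)) / enorm (y - x)| <= eps.
    have := h _ eps0; rewrite !near_withinE.
    by apply: filterS => y hy yc yx; apply: hy.
  exists delta => // y yc yd i; rewrite -E.
  have [->|yx] := eqVneq y x.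
    by rewrite !subrr mulmx0 subr0 mxE normr0 mulr_ge0 ?l1_ge0// ltW.
  have := hd y yc yd yx; rewrite ger0_norm ?divr_ge0 ?enorm_ge0//.
  have e0 : 0 < enorm (y - x).
    rewrite lt_neqAle enorm_ge0 andbT eq_sym; apply: contra_neq yx => e0.
    apply/colP => j; apply/eqP; rewrite -subr_eq0 -normr_le0 -e0.
    by have := coord_le_enorm (y - x) j; rewrite !mxE.
  rewrite ler_pdivrMr// => /(le_trans (coord_le_enorm _ i))/le_trans; apply.
  by rewrite ler_pM2l//; exact: enorm_le_sum.
move=> h; apply/cvgr0Pnorm_le => eps eps0.
(* Successors keep the denominator positive when [m] or [d] is 0. *)
have c0 : 0 < eps / (m.+1%:R * d.+1%:R) by rewrite divr_gt0// mulr_gt0.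
have [delta d0 hd] := h _ c0.
have : \forall y \near within (cube R d) (nbhs x),
    `|enorm (f y - f x - A *m (y - x)) / enorm (y - x)| <= eps.
  apply/near_within_cube; exists delta => // y yc yd.
  rewrite ger0_norm ?divr_ge0 ?enorm_ge0//.
  have [->|e0] := eqVneq (enorm (y - x)) 0; first by rewrite invr0 mulr0 ltW.
  have {}e0 : 0 < enorm (y - x) by rewrite lt_neqAle eq_sym e0 enorm_ge0.
  rewrite ler_pdivrMr//.
  have H i : `|(f y - f x - A *m (y - x)) i 0| <=
      eps / (m.+1%:R * d.+1%:R) * (d.+1%:R * enorm (y - x)).
    rewrite E; apply: le_trans (hd y yc yd i) _; rewrite ler_pM2l//.
    apply: le_trans (l1_le (fun j => coord_le_enorm _ j)) _.
    by rewrite ler_pM2r// ler_nat.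
  apply: le_trans (enorm_le_max H) _.
  have -> : eps / (m.+1%:R * d.+1%:R) * (d.+1%:R * enorm (y - x)) =
     m.+1%:R^-1 * (eps * enorm (y - x)).
    have : (m.+1%:R : R) != 0 by []. have : (d.+1%:R : R) != 0 by [].
    move: (m.+1%:R) (d.+1%:R) => u v v0 u0; field; exact/andP.
  rewrite mulrA; apply: ler_piMl; first by rewrite mulr_ge0// ltW.
  by rewrite ler_pdivrMr// mul1r ler_nat.
rewrite !near_withinE; apply: filterS => y hy yx yc; exact: hy.
Qed.

Lemma has_jacobian_unique (R : realType) d m (f : 'cV[R]_d -> 'cV[R]_m) x
    (A B : 'M[R]_(m, d)) :
  cube R d x -> has_jacobian f x A -> has_jacobian f x B -> A = B.
Proof.
move=> xc /has_jacobianP hA /has_jacobianP hB; apply/matrixP => i j.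
apply/eqP; rewrite -subr_eq0 -normr_le0; apply/ler_addgt0Pr => eps eps0.
rewrite add0r; have e2 : 0 < eps / 2 by rewrite divr_gt0.
have [da da0 {}hA] := hA _ e2; have [db db0 {}hB] := hB _ e2.
pose h0 := Num.min (1 / 2) (Num.min da db / 2).
have h00 : 0 < h0 by rewrite /h0 lt_min !divr_gt0// lt_min da0 db0.
have h0a : h0 < da.
  rewrite /h0 gt_min; apply/orP; right; rewrite ltr_pdivrMr//.
  by rewrite gt_min; apply/orP; left; lra.
have h0b : h0 < db.
  rewrite /h0 gt_min; apply/orP; right; rewrite ltr_pdivrMr//.
  by rewrite gt_min; apply/orP; right; lra.
have h01 : h0 <= 1 / 2 by rewrite /h0 ge_min lexx.
(* The increment points towards the farther of the two faces. As [h0] is at most 1/2, the point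
   stays in the cube, also when [x] is on the boundary. *)
pose h := if x j 0 <= 1 / 2 then h0 else - h0.
have nh : `|h| = h0 by rewrite /h; case: ifP => _; rewrite ?normrN gtr0_norm.
pose y : 'cV[R]_d := \col_k (x k 0 + (if k == j then h else 0)).
have yE k : y k 0 - x k 0 = if k == j then h else 0.
  by rewrite mxE addrAC subrr add0r.
have yc : cube R d y.
  move=> k; rewrite mxE; case: eqP => [->|_]; last by rewrite addr0.
  have /andP[x0 x1] := xc j.
  by rewrite /h; case: (lerP (x j 0) (1/2)) => hx; apply/andP; split; lra.
have close e : h0 < e -> 0 < e -> forall k, `|y k 0 - x k 0| < e.
  by move=> he e0 k; rewrite yE; case: eqP => _; rewrite ?nh ?normr0.
have S (M : 'M[R]_(m, d)) : \sum_k M i k * (y k 0 - x k 0) = M i j * h.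
  rewrite (bigD1 j)//= big1 ?addr0 ?yE ?eqxx// => k kj.
  by rewrite yE (negbTE kj) mulr0.
have l1E : l1 (y - x) = h0.
  have yxE k : (y - x) k 0 = if k == j then h else 0.
    by rewrite -yE [LHS]mxE [X in _ + X]mxE.
  rewrite /l1 (bigD1 j)//= big1 ?addr0 => [|k kj]; rewrite yxE ?eqxx//.
  by rewrite (negbTE kj) normr0.
have := hA y yc (close _ h0a da0) i; have := hB y yc (close _ h0b db0) i.
rewrite !S l1E => hb ha.
have : `|(A i j - B i j) * h| <= eps * h0.
  have -> : (A i j - B i j) * h = (f y i 0 - f x i 0 - B i j * h) -
    (f y i 0 - f x i 0 - A i j * h) by ring.
  by apply: le_trans (ler_normB _ _) _; lra.
by rewrite normrM nh ler_pM2r.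
Qed.

Lemma jacE (R : realType) d m (f : 'cV[R]_d -> 'cV[R]_m) x (A : 'M[R]_(m, d)) :
  cube R d x -> has_jacobian f x A -> jac f x = A.
Proof.
move=> xc hA; suff hJ : has_jacobian f x (jac f x).
  exact: has_jacobian_unique xc hJ hA.
by rewrite /jac; case: xgetP => [B -> //|/(_ A)].
Qed.

Lemma has_jacobian_jac (R : realType) d m (f : 'cV[R]_d -> 'cV[R]_m) x :
  C1 f -> cube R d x -> has_jacobian f x (jac f x).
Proof. by move=> [+ _] xc => /(_ x xc)[A hA]; rewrite (jacE xc hA). Qed.

Lemma has_jacobianB (R : realType) d m (f g : 'cV[R]_d -> 'cV[R]_m) x A B :
  has_jacobian f x A -> has_jacobian g x B ->
  has_jacobian (f \- g) x (A - B).
Proof.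
move=> /has_jacobianP hA /has_jacobianP hB; apply/has_jacobianP => eps eps0.
have e2 : 0 < eps / 2 by rewrite divr_gt0.
have [da da0 {}hA] := hA _ e2; have [db db0 {}hB] := hB _ e2.
exists (Num.min da db); first by rewrite lt_min da0 db0.
move=> y yc yd i.
have ha : `|f y i 0 - f x i 0 - \sum_j A i j * (y j 0 - x j 0)| <=
    eps / 2 * l1 (y - x).
  by apply: hA => // j; apply: lt_le_trans (yd j) _; rewrite ge_min lexx.
have hb : `|g y i 0 - g x i 0 - \sum_j B i j * (y j 0 - x j 0)| <=
    eps / 2 * l1 (y - x).
  by apply: hB => // j; apply: lt_le_trans (yd j) _; rewrite ge_min lexx orbT.
rewrite !mxE; under eq_bigr do rewrite !mxE mulrDl mulNr.
rewrite big_split /= sumrN.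
set a := \sum_j A _ _ * _ in ha *; set b := \sum_j B _ _ * _ in hb *.
have -> : f y i 0 - g y i 0 - (f x i 0 - g x i 0) - (a - b) =
  (f y i 0 - f x i 0 - a) - (g y i 0 - g x i 0 - b) by ring.
apply: le_trans (ler_normB _ _) _.
lra.
Qed.

(** * Operator norm and entries, Lipschitz gradients *)

Lemma opnorm_bound (R : realType) m d (A : 'M[R]_(m, d)) r :
  (forall i j, `|A i j| <= r) ->
  forall v, enorm v <= 1 -> enorm (A *m v) <= m%:R * (d%:R * r).
Proof.
move=> h v v1; apply: enorm_le_max => i; rewrite mxE.
apply: le_trans (ler_norm_sum _ _ _) _.
have -> : d%:R * r = \sum_(i < d) r by rewrite sumr_const card_ord mulr_natl.
apply: ler_sum => j _; rewrite normrM; apply: le_trans (h i j).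
by rewrite ler_piMr// (le_trans (coord_le_enorm v j)).
Qed.

Lemma opnorm_le (R : realType) m d (A : 'M[R]_(m, d)) r :
  (forall i j, `|A i j| <= r) -> opnorm A <= m%:R * (d%:R * r).
Proof.
move=> h; apply: ge_sup; last by move=> _ [v v1 <-]; exact: opnorm_bound h v v1.
exists (enorm (A *m (0 : 'cV_d))), 0 => //=.
by rewrite /enorm big1 ?sqrtr0// => i _; rewrite mxE expr0n.
Qed.

Lemma entry_le_opnorm (R : realType) m d (A : 'M[R]_(m, d)) i j :
  `|A i j| <= opnorm A.
Proof.
pose v : 'cV[R]_d := \col_k (k == j)%:R.
have -> : A i j = (A *m v) i 0.
  rewrite mxE (bigD1 j)//= big1 ?mxE ?eqxx ?mulr1 ?addr0// => k kj.
  by rewrite mxE (negbTE kj) mulr0.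
apply: le_trans (coord_le_enorm _ _) _; apply: ub_le_sup.
  (* A supremum dominates its members only if the set is bounded; the sum of all entries provides a
     bound. *)
  exists (m%:R * (d%:R * \sum_i \sum_j `|A i j|)) => _ [w w1 <-].
  apply: opnorm_bound w1 => a b.
  rewrite (bigD1 a)//= (bigD1 b)//= -addrA lerDl addr_ge0 ?sumr_ge0// => k _.
  exact: sumr_ge0.
exists v => //=; apply: le_trans (enorm_le_sum v) _.
rewrite (bigD1 j)//= big1 ?mxE ?eqxx ?normr1 ?addr0// => k kj.
by rewrite mxE (negbTE kj) normr0.
Qed.

Lemma lipschitz_within_continuous (R : realType) m d
    (J : 'cV[R]_d -> 'M[R]_(m, d)) K :
  (forall x y i j, cube R d x -> cube R d y ->
     `|J y i j - J x i j| <= K * l1 (y - x)) ->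
  {within cube R d, continuous J}.
Proof.
move=> h; apply/subspace_continuousP => x xc; apply/cvgrPdist_lt => eps eps0.
have M0 : 0 < d.+1%:R * (`|K| + 1) by rewrite mulr_gt0.
apply/near_within_cube; exists (eps / 2 / (d.+1%:R * (`|K| + 1))).
  by rewrite !divr_gt0.
move=> y yc yd.
have yl : l1 (y - x) <= d.+1%:R * (eps / 2 / (d.+1%:R * (`|K| + 1))).
  apply: le_trans (l1_le (r := eps / 2 / (d.+1%:R * (`|K| + 1))) _) _.
    by move=> j; rewrite !mxE ltW.
  by rewrite ler_wpM2r ?ler_nat// ltW// !divr_gt0.
have e2 : 0 < eps / 2 by rewrite divr_gt0.
have : `|J x - J y| <= eps / 2.
  rewrite [leLHS]mx_normrE; apply: bigmax_le => [|[i j] _]; first exact: ltW.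
  rewrite !mxE distrC; apply: le_trans (h x y i j xc yc) _.
  apply: le_trans (_ : (`|K| + 1) * l1 (y - x) <= _).
    by rewrite ler_wpM2r ?l1_ge0// ler_wpDr// ler_norm.
  rewrite mulrC -ler_pdivlMr//; apply: le_trans yl _.
  rewrite le_eqVlt; apply/orP; left; apply/eqP; field.
  by rewrite gt_eqF//= -natr1 gt_eqF.
by move/le_lt_trans; apply; lra.
Qed.

(** A function with Lipschitz gradient [w], all estimates sharing one constant. This form is stable
    under sums and products, and its quadratic remainder yields the Jacobian relative to the closed
    cube, boundary included. *)
Definition C11 (R : realType) d (u : 'cV[R]_d -> R)
    (w : 'I_d -> 'cV[R]_d -> R) : Prop :=
  exists K : R, 0 <= K /\ forall x y, cube R d x -> cube R d y ->
    [/\ `|u x| <= K, forall j, `|w j x| <= K,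
        `|u y - u x| <= K * l1 (y - x),
        forall j, `|w j y - w j x| <= K * l1 (y - x) &
        `|u y - u x - \sum_j w j x * (y j 0 - x j 0)| <= K * l1 (y - x) ^+ 2].

Lemma C11_ext (R : realType) d (u u' : 'cV[R]_d -> R) w w' :
  u =1 u' -> (forall j, w j =1 w' j) -> C11 u w -> C11 u' w'.
Proof.
move=> uu ww [K [K0 h]]; exists K; split=> // x y xc yc.
have [h1 h2 h3 h4 h5] := h x y xc yc; split; rewrite -?uu//.
- by move=> j; rewrite -ww.
- by move=> j; rewrite -!ww.
- by under eq_bigr do rewrite -ww.
Qed.

Lemma C11_cst (R : realType) d (c : R) :
  C11 (fun _ : 'cV[R]_d => c) (fun _ _ => 0).
Proof.
exists `|c|; split=> // x y _ _; split=> // [j||j|]; rewrite ?subrr ?normr0 ?mulr_ge0 ?l1_ge0//.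
by rewrite big1 ?subrr ?normr0 ?mulr_ge0 ?exprn_ge0 ?l1_ge0// => j _; rewrite mul0r.
Qed.

Lemma C11D (R : realType) d (u1 u2 : 'cV[R]_d -> R) w1 w2 :
  C11 u1 w1 -> C11 u2 w2 ->
  C11 (fun x => u1 x + u2 x) (fun j x => w1 j x + w2 j x).
Proof.
move=> [K [K0 h]] [K' [K0' h']]; exists (K + K'); split; first exact: addr_ge0.
move=> x y xc yc; have [h1 h2 h3 h4 h5] := h x y xc yc.
have [h1' h2' h3' h4' h5'] := h' x y xc yc; split.
- by rewrite (le_trans (ler_normD _ _))// lerD.
- by move=> j; rewrite (le_trans (ler_normD _ _))// lerD.
- by rewrite mulrDl opprD addrACA (le_trans (ler_normD _ _))// lerD.
- by move=> j; rewrite mulrDl opprD addrACA (le_trans (ler_normD _ _))// lerD.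
under eq_bigr do rewrite mulrDl.
rewrite big_split /= mulrDl.
set s1 := \sum_j w1 j x * _ in h5 *; set s2 := \sum_j w2 j x * _ in h5' *.
rewrite (_ : _ - _ = (u1 y - u1 x - s1) + (u2 y - u2 x - s2)); last by ring.
by rewrite (le_trans (ler_normD _ _))// lerD.
Qed.

Lemma C11M (R : realType) d (u1 u2 : 'cV[R]_d -> R) w1 w2 :
  C11 u1 w1 -> C11 u2 w2 ->
  C11 (fun x => u1 x * u2 x) (fun j x => u1 x * w2 j x + w1 j x * u2 x).
Proof.
(* The factor 4 comes from the difference of the gradients, which splits into four products, each at
   most K L times the distance. *)
move=> [K [K0 h]] [L [L0 h']]; exists (4 * K * L); split; first by rewrite !mulr_ge0.
move=> x y xc yc; have [h1 h2 h3 h4 h5] := h x y xc yc.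
have [h1' h2' h3' h4' h5'] := h' x y xc yc.
have [g1 _ _ _ _] := h y x yc xc; have [g1' g2' _ _ _] := h' y x yc xc.
have KL : 0 <= K * L by rewrite mulr_ge0.
have D0 := l1_ge0 (y - x); set D := l1 _ in D0 h3 h4 h5 h3' h4' h5' *.
have M (a b A B : R) : `|a| <= A -> `|b| <= B -> `|a * b| <= A * B.
  by move=> ha hb; rewrite normrM ler_pM.
have D2 : 0 <= D * D by rewrite mulr_ge0.
have KLD : 0 <= K * L * D by rewrite mulr_ge0.
have KLD2 : 0 <= K * L * (D * D) by rewrite mulr_ge0.
split.
- by apply: le_trans (M _ _ _ _ h1 h1') _; lra.
- move=> j; apply: le_trans (ler_normD _ _) _.
  by have := M _ _ _ _ h1 (h2' j); have := M _ _ _ _ (h2 j) h1'; lra.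
- rewrite (_ : _ - _ = u1 y * (u2 y - u2 x) + (u1 y - u1 x) * u2 x); last by ring.
  apply: le_trans (ler_normD _ _) _.
  by have := M _ _ _ _ g1 h3'; have := M _ _ _ _ h3 h1'; lra.
- move=> j.
  rewrite (_ : _ - _ = (u1 y * (w2 j y - w2 j x) + (u1 y - u1 x) * w2 j x) +
    (w1 j x * (u2 y - u2 x) + (w1 j y - w1 j x) * u2 y)); last by ring.
  apply: le_trans (ler_normD _ _) _.
  have := ler_normD (u1 y * (w2 j y - w2 j x)) ((u1 y - u1 x) * w2 j x).
  have := ler_normD (w1 j x * (u2 y - u2 x)) ((w1 j y - w1 j x) * u2 y).
  have := M _ _ _ _ g1 (h4' j); have := M _ _ _ _ h3 (h2' j).
  have := M _ _ _ _ (h2 j) h3'; have := M _ _ _ _ (h4 j) g1'.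
  by lra.
under eq_bigr do rewrite mulrDl -mulrA (mulrC (w1 _ _)) -(mulrA (u2 _)).
rewrite big_split /= -!mulr_sumr.
set s1 := \sum_j w1 j x * _ in h5 *; set s2 := \sum_j w2 j x * _ in h5' *.
(* The product of the two increments is quadratic in the distance, so it belongs to the
   remainder. *)
rewrite (_ : _ - _ = u1 x * (u2 y - u2 x - s2) + (u1 y - u1 x - s1) * u2 x +
  (u1 y - u1 x) * (u2 y - u2 x)); last by ring.
apply: le_trans (ler_normD _ _) _.
have := ler_normD (u1 x * (u2 y - u2 x - s2)) ((u1 y - u1 x - s1) * u2 x).
have := M _ _ _ _ h1 h5'; have := M _ _ _ _ h5 h1'; have := M _ _ _ _ h3 h3'.
rewrite expr2; lra.
Qed.

Lemma C11_sum (R : realType) d I (r : seq I) (u : I -> 'cV[R]_d -> R) w :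
  (forall i, C11 (u i) (w i)) ->
  C11 (fun x => \sum_(i <- r) u i x) (fun j x => \sum_(i <- r) w i j x).
Proof.
move=> h; elim: r => [|i r IH].
  apply: C11_ext (C11_cst d 0) => [x|j x]; by rewrite big_nil.
apply: C11_ext (C11D (h i) IH) => [x|j x]; by rewrite big_cons.
Qed.

Lemma C11_coord (R : realType) d (i : 'I_d) (v v' : R -> R) K : 0 <= K ->
  (forall s t, 0 <= s <= 1 -> 0 <= t <= 1 ->
    [/\ `|v s| <= K, `|v' s| <= K, `|v t - v s| <= K * `|t - s|,
        `|v' t - v' s| <= K * `|t - s| &
        `|v t - v s - v' s * (t - s)| <= K * `|t - s| ^+ 2]) ->
  C11 (fun x : 'cV[R]_d => v (x i 0))
      (fun j x => if i == j then v' (x i 0) else 0).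
Proof.
move=> K0 h; exists K; split=> // x y xc yc.
have [h1 h2 h3 h4 h5] := h _ _ (xc i) (yc i).
have yx : `|y i 0 - x i 0| <= l1 (y - x).
  by have := coord_le_l1 (y - x) i; rewrite !mxE.
split=> //.
- by move=> j; case: eqP => // _; rewrite normr0.
- by apply: le_trans h3 _; rewrite ler_wpM2l.
- move=> j; case: eqP => _; first by apply: le_trans h4 _; rewrite ler_wpM2l.
  by rewrite subrr normr0 mulr_ge0 ?l1_ge0.
rewrite (bigD1 i)//= eqxx big1 ?addr0 => [|j ji]; last first.
  by rewrite eq_sym (negbTE ji) mul0r.
apply: le_trans h5 _; rewrite ler_wpM2l// ler_pXn2r ?nnegrE ?l1_ge0//.
Qed.

Lemma C11_tensor (R : realType) d (v v' : 'I_d -> R -> R) :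
  (forall i, C11 (fun x : 'cV[R]_d => v i (x i 0))
      (fun j x => if i == j then v' i (x i 0) else 0)) ->
  C11 (fun x : 'cV[R]_d => \prod_i v i (x i 0))
      (fun j x => \prod_i (if i == j then v' i (x i 0) else v i (x i 0))).
Proof.
move=> h.
(* A product over part of the coordinates has derivative 0 in the others, hence the indicator; by
   [uniq], each coordinate occurs in one factor only. *)
suff H (s : seq 'I_d) : uniq s -> C11 (fun x : 'cV[R]_d => \prod_(i <- s) v i (x i 0))
    (fun j x => (j \in s)%:R *
       \prod_(i <- s) (if i == j then v' i (x i 0) else v i (x i 0))).
  apply: C11_ext (H _ (index_enum_uniq _)) => // j x.
  by rewrite mem_index_enum mul1r.
elim: s => [_|a s IH /= /andP[aS /IH{}IH]].
  by apply: C11_ext (C11_cst d 1) => [x|j x]; rewrite big_nil// mul0r.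
apply: C11_ext (C11M (h a) IH) => [x|j x]; rewrite big_cons// inE eq_sym.
have [<-|ja] := eqVneq a j; last by rewrite mul0r addr0 mulrCA.
rewrite (negbTE aS) mul0r mulr0 add0r mul1r; congr (_ * _).
rewrite big_seq [in RHS]big_seq; apply: eq_bigr => k ks.
by case: eqP => // ka; rewrite -ka ks in aS.
Qed.

Lemma C11_C1 (R : realType) d m (g : 'cV[R]_d -> 'cV[R]_m)
    (G : 'cV[R]_d -> 'M[R]_(m, d)) :
  (forall i, C11 (fun x => g x i 0) (fun j x => G x i j)) ->
  (forall x, cube R d x -> has_jacobian g x (G x)) /\ C1 g.
Proof.
move=> /choice[K h].
pose M := \sum_i K i.
have K0 i : 0 <= K i by have [] := h i.
have KM i : K i <= M by rewrite /M (bigD1 i)//= lerDl sumr_ge0.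
have M0 : 0 <= M by apply: sumr_ge0.
have hJ x : cube R d x -> has_jacobian g x (G x).
  move=> xc; apply/has_jacobianP => eps eps0.
  have c0 : 0 < d.+1%:R * (M + 1) by rewrite mulr_gt0// ltr_wpDl.
  exists (eps / (d.+1%:R * (M + 1))); first exact: divr_gt0.
  move=> y yc yd i; have [_ _ _ _ h5] := (h i).2 x y xc yc.
  apply: le_trans h5 _; rewrite expr2 mulrA ler_wpM2r ?l1_ge0//.
  apply: le_trans (_ : (M + 1) * l1 (y - x) <= _).
    by rewrite ler_wpM2r ?l1_ge0// ler_wpDr.
  rewrite mulrC -ler_pdivlMr ?ltr_wpDl//.
  apply: le_trans (l1_le (r := eps / (d.+1%:R * (M + 1))) _) _.
    by move=> j; rewrite !mxE ltW.
  have -> : d%:R * (eps / (d.+1%:R * (M + 1))) =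
    d.+1%:R^-1 * d%:R * (eps / (M + 1)) by rewrite invfM; ring.
  apply: ler_piMl.
    by rewrite mulr_ge0 ?invr_ge0 ?addr_ge0// ltW.
  by rewrite ler_pdivrMl// mulr1 ler_nat.
split=> //; split=> [x xc|]; first by exists (G x); exact: hJ.
apply: (@lipschitz_within_continuous _ _ _ _ M) => x y i j xc yc.
rewrite (jacE xc (hJ x xc)) (jacE yc (hJ y yc)).
have [_ _ _ h4 _] := (h i).2 x y xc yc.
by apply: le_trans (h4 j) _; rewrite ler_wpM2r ?l1_ge0.
Qed.

(** * A C^1 piecewise polynomial partition of unity *)

Definition clamp (R : realType) (u : R) : R :=
  if u <= 0 then 0 else if 1 <= u then 1 else u.

(** The cubic 3u^2 - 2u^3, extended by the constants 0 and 1. Its derivative vanishes at both ends,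
    so the gluing is C^1. *)
Definition step (R : realType) (u : R) : R := clamp u ^+ 2 * (3 - 2 * clamp u).
Definition dstep (R : realType) (u : R) : R := 6 * clamp u * (1 - clamp u).

Lemma clampP (R : realType) (u : R) :
  [\/ u <= 0 /\ clamp u = 0, 0 <= u <= 1 /\ clamp u = u |
      1 <= u /\ clamp u = 1].
Proof.
rewrite /clamp; case: lerP => u0; first by constructor 1.
case: (lerP 1 u) => u1; first by constructor 3.
by constructor 2; split=> //; rewrite !ltW.
Qed.

Lemma step_le0 (R : realType) (u : R) : u <= 0 -> step u = 0.
Proof. by rewrite /step /clamp => ->; rewrite expr0n mul0r. Qed.

Lemma step_ge1 (R : realType) (u : R) : 1 <= u -> step u = 1.
Proof.
move=> u1; rewrite /step /clamp u1 leNgt (lt_le_trans ltr01 u1)/=; ring.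
Qed.

Lemma step_in (R : realType) (u : R) : 0 <= u <= 1 -> step u = u ^+ 2 * (3 - 2 * u).
Proof.
move=> /andP[u0 u1]; rewrite /step.
by have [[h ->]|[_ ->]|[h ->]] := clampP u => //;
   [have -> : u = 0 by lra|have -> : u = 1 by lra].
Qed.

Lemma dstep_le0 (R : realType) (u : R) : u <= 0 -> dstep u = 0.
Proof. by rewrite /dstep /clamp => ->; rewrite mulr0 mul0r. Qed.

Lemma dstep_ge1 (R : realType) (u : R) : 1 <= u -> dstep u = 0.
Proof.
by move=> u1; rewrite /dstep /clamp u1 leNgt (lt_le_trans ltr01 u1)/= subrr mulr0.
Qed.

Lemma dstep_in (R : realType) (u : R) : 0 <= u <= 1 -> dstep u = 6 * u * (1 - u).
Proof.
move=> /andP[u0 u1]; rewrite /dstep.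
by have [[h ->]|[_ ->]|[h ->]] := clampP u => //;
   [have -> : u = 0 by lra|have -> : u = 1 by lra].
Qed.

Lemma step01 (R : realType) (u : R) : 0 <= step u <= 1.
Proof.
have [[u0 _]|[h _]|[u1 _]] := clampP u.
- by rewrite step_le0// lexx ler01.
- rewrite step_in//; move: h => /andP[u0 u1].
  (* This product equals 1 - (3u^2 - 2u^3). *)
  have h : 0 <= (1 - u) ^+ 2 * (1 + 2 * u) by rewrite mulr_ge0 ?sqr_ge0//; lra.
  by apply/andP; split; [rewrite mulr_ge0 ?sqr_ge0//; lra|lra].
- by rewrite step_ge1// lexx ler01.
Qed.

Lemma dstep_bound (R : realType) (u : R) : 0 <= dstep u <= 2.
Proof.
have [[u0 _]|[h _]|[u1 _]] := clampP u.
- by rewrite dstep_le0// lexx ler0n.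
- rewrite dstep_in//; move: h => /andP[u0 u1]; apply/andP; split; nra.
- by rewrite dstep_ge1// lexx ler0n.
Qed.

Lemma clamp_lip (R : realType) (u v : R) : `|clamp v - clamp u| <= `|v - u|.
Proof.
have [[u0 ->]|[/andP[u0 u1] ->]|[u1 ->]] := clampP u;
have [[v0 ->]|[/andP[v0 v1] ->]|[v1 ->]] := clampP v;
rewrite ?subrr ?normr0//; case: (ger0P (v - u)) => h;
by rewrite ler_norml; apply/andP; split; lra.
Qed.

Lemma clamp01 (R : realType) (u : R) : 0 <= clamp u <= 1.
Proof.
have [[u0 ->]|[h ->]|[u1 ->]] := clampP u => //; by rewrite ?lexx ?ler01.
Qed.

Lemma dstep_lip (R : realType) (u v : R) : `|dstep v - dstep u| <= 6 * `|v - u|.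
Proof.
rewrite /dstep; have := clamp_lip u v; have := clamp01 u; have := clamp01 v.
move: (clamp u) (clamp v) => a b /andP[b0 b1] /andP[a0 a1] h.
have -> : 6 * b * (1 - b) - 6 * a * (1 - a) = 6 * ((b - a) * (1 - a - b)) by ring.
rewrite normrM [`|6|]ger0_norm// ler_pM2l// normrM; apply: le_trans h.
by apply: ler_piMr => //; rewrite ler_norml; apply/andP; split; lra.
Qed.

Lemma step_lip (R : realType) (u v : R) : `|step v - step u| <= 6 * `|v - u|.
Proof.
rewrite /step; have := clamp_lip u v; have := clamp01 u; have := clamp01 v.
move: (clamp u) (clamp v) => a b /andP[b0 b1] /andP[a0 a1] h.
have -> : b ^+ 2 * (3 - 2 * b) - a ^+ 2 * (3 - 2 * a) =
  (b - a) * (3 * (a + b) - 2 * (a * a + a * b + b * b)) by ring.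
rewrite normrM mulrC; apply: ler_pM => //.
have P (s t : R) : 0 <= s -> s <= 1 -> 0 <= t -> t <= 1 -> 0 <= s * t <= 1.
  by move=> *; rewrite mulr_ge0// mulr_ile1.
have /andP[? ?] := P _ _ a0 a1 a0 a1; have /andP[? ?] := P _ _ a0 a1 b0 b1.
have /andP[? ?] := P _ _ b0 b1 b0 b1.
by rewrite ler_norml; apply/andP; split; lra.
Qed.

Lemma step_taylor (R : realType) (u v : R) :
  `|step v - step u - dstep u * (v - u)| <= 6 * `|v - u| ^+ 2.
Proof.
rewrite real_normK ?num_real// ler_norml.
have q0 := sqr_ge0 (v - u).
(* [P] serves when [u] is in [0,1] and [v] outside, [Q] when [v] is in [0,1] and [u] outside. Here
   [w] is the distance of the inner point to the end that is crossed; the end 1 reduces to the end 0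
   by the symmetry of [step]. *)
have P (w h : R) : 0 <= w -> w <= 1 -> w <= h ->
    - (6 * h ^+ 2) <= w ^+ 2 * (3 - 2 * w) - 6 * w * (1 - w) * h <= 6 * h ^+ 2.
  move=> w0 w1 wh.
  have h0 : 0 <= h by lra. have w1' : 0 <= 1 - w by lra.
  have wh' : 0 <= h - w by lra.
  have := mulr_ge0 h0 wh'; have := mulr_ge0 w0 wh'.
  have := mulr_ge0 (mulr_ge0 w0 w0) w0; have := mulr_ge0 (mulr_ge0 w0 w0) h0.
  have := mulr_ge0 (mulr_ge0 w0 w0) w1'; have := mulr_ge0 (mulr_ge0 w0 h0) w1'.
  by move=> *; apply/andP; split; lra.
have Q (w h : R) : 0 <= w -> w <= 1 -> w <= h ->
    - (6 * h ^+ 2) <= w ^+ 2 * (3 - 2 * w) <= 6 * h ^+ 2.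
  move=> w0 w1 wh.
  have h0 : 0 <= h by lra. have w1' : 0 <= 1 - w by lra.
  have wh' : 0 <= h - w by lra.
  have := mulr_ge0 h0 wh'; have := mulr_ge0 w0 wh'.
  have := mulr_ge0 (mulr_ge0 w0 w0) w0; have := mulr_ge0 (mulr_ge0 w0 w0) w1'.
  by move=> *; apply/andP; split; lra.
have one (h : R) : 1 <= h -> 1 <= h ^+ 2 by move=> h1; rewrite exprn_ege1.
have [[u0 _]|[hu _]|[u1 _]] := clampP u;
have [[v0 _]|[hv _]|[v1 _]] := clampP v;
rewrite ?(step_le0 u0) ?(step_le0 v0) ?(step_ge1 u1) ?(step_ge1 v1)
  ?(dstep_le0 u0) ?(dstep_ge1 u1) ?(step_in hu) ?(step_in hv) ?(dstep_in hu);
rewrite ?mul0r ?subrr ?subr0 ?sub0r.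
- by apply/andP; split; lra.
- by move: hv => /andP[b0 b1]; apply: Q => //; lra.
- by have := one (v - u); move=> /(_ ltac:(lra)) ?; apply/andP; split; lra.
- move: hu => /andP[a0 a1].
  have : u <= u - v by lra.
  by move=> /(P _ _ a0 a1) /andP[h1 h2]; apply/andP; split; lra.
- move: hu hv => /andP[a0 a1] /andP[b0 b1].
  have -> : v ^+ 2 * (3 - 2 * v) - u ^+ 2 * (3 - 2 * u) - 6 * u * (1 - u) * (v - u)
    = (v - u) ^+ 2 * (3 - 2 * v - 4 * u) by ring.
  move: ((v - u) ^+ 2) q0 => q q0.
  have a1' : 0 <= 1 - u by lra. have b1' : 0 <= 1 - v by lra.
  have := mulr_ge0 q0 a0; have := mulr_ge0 q0 b0.
  have := mulr_ge0 q0 a1'; have := mulr_ge0 q0 b1'.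
  by move=> *; apply/andP; split; lra.
- move: hu => /andP[a0 a1].
  have h : 1 - u <= v - u by lra.
  have a1' : 0 <= 1 - u by lra. have a0' : 1 - u <= 1 by lra.
  by have /andP[h1 h2] := P _ _ a1' a0' h; apply/andP; split; lra.
- by have := one (u - v); move=> /(_ ltac:(lra)) ?; apply/andP; split; lra.
- move: hv => /andP[b0 b1].
  have h : 1 - v <= u - v by lra.
  have b1' : 0 <= 1 - v by lra. have b0' : 1 - v <= 1 by lra.
  by have /andP[h1 h2] := Q _ _ b1' b0' h; apply/andP; split; lra.
- by apply/andP; split; lra.
Qed.

(** A C^1 bump supported in [-1,1]. Being a difference of consecutive steps, it has integer
    translates whose sums telescope. *)
Definition bump (R : realType) (t : R) : R := step (t + 1) - step t.
Definition dbump (R : realType) (t : R) : R := dstep (t + 1) - dstep t.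

Lemma bump_ge0 (R : realType) (t : R) : 0 <= bump t.
Proof.
rewrite /bump; have /andP[s0 s1] := step01 t; have /andP[r0 r1] := step01 (t + 1).
have [t0|t0] := lerP t 0; first by rewrite (step_le0 t0) subr0.
by rewrite (@step_ge1 _ (t + 1)) ?subr_ge0//; lra.
Qed.

Lemma bump_out (R : realType) (t : R) : 1 <= `|t| -> bump t = 0.
Proof.
rewrite /bump ler_normr => /orP[h|h].
  by rewrite !step_ge1 ?subrr//; lra.
by rewrite !step_le0 ?subrr//; lra.
Qed.

Lemma dbump_out (R : realType) (t : R) : 1 <= `|t| -> dbump t = 0.
Proof.
rewrite /dbump ler_normr => /orP[h|h].
  by rewrite !dstep_ge1 ?subrr//; lra.
by rewrite !dstep_le0 ?subrr//; lra.
Qed.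

(** At a node, neighbouring Taylor polynomials therefore do not contribute to the Jacobian of the
    blend, although their values there may differ. *)
Lemma dbump_nat (R : realType) (a b : nat) : dbump (a%:R - b%:R : R) = 0.
Proof.
have [ab|ab|->] := ltngtP a b.
- apply: dbump_out; rewrite ler_normr; apply/orP; right.
  by rewrite opprB lerBrDr addrC natr1 ler_nat.
- apply: dbump_out; rewrite ler_normr; apply/orP; left.
  by rewrite lerBrDr addrC natr1 ler_nat.
by rewrite subrr /dbump add0r dstep_ge1// dstep_le0// subrr.
Qed.

Lemma bump_nat (R : realType) (a b : nat) : bump (a%:R - b%:R : R) = (a == b)%:R.
Proof.
have [ab|ab|->] := ltngtP a b.
- apply: bump_out; rewrite ler_normr; apply/orP; right.
  by rewrite opprB lerBrDr addrC natr1 ler_nat.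
- apply: bump_out; rewrite ler_normr; apply/orP; left.
  by rewrite lerBrDr addrC natr1 ler_nat.
by rewrite subrr /bump add0r step_ge1// step_le0// subr0.
Qed.

Lemma sum_bump (R : realType) n (t : R) : 0 <= t <= n%:R ->
  \sum_(k < n.+1) bump (t - k%:R) = 1.
Proof.
move=> /andP[t0 tn].
(* The sum telescopes to step (t + 1) - step (t - n), and both arguments lie where [step] is
   constant. *)
have : \sum_(0 <= k < n.+1) (- step (t + 1 - k.+1%:R) - - step (t + 1 - k%:R)) =
    - step (t + 1 - n.+1%:R) - - step (t + 1 - 0%:R).
  exact: (telescope_sumr (fun k => - step (t + 1 - k%:R))).
rewrite (@step_le0 _ (t + 1 - n.+1%:R)) => [|]; last by rewrite -natr1; lra.
rewrite (@step_ge1 _ (t + 1 - 0%:R)) => [|]; last by lra.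
rewrite oppr0 opprK add0r => H; rewrite -[RHS]H big_mkord; apply: eq_bigr => k _.
have -> : t + 1 - k.+1%:R = t - k%:R by rewrite -natr1; ring.
have -> : t + 1 - k%:R = t - k%:R + 1 by ring.
by rewrite /bump opprK [RHS]addrC.
Qed.

Lemma sum_dbump (R : realType) n (t : R) : 0 <= t <= n%:R ->
  \sum_(k < n.+1) dbump (t - k%:R) = 0.
Proof.
move=> /andP[t0 tn].
have : \sum_(0 <= k < n.+1) (- dstep (t + 1 - k.+1%:R) - - dstep (t + 1 - k%:R)) =
    - dstep (t + 1 - n.+1%:R) - - dstep (t + 1 - 0%:R).
  exact: (telescope_sumr (fun k => - dstep (t + 1 - k%:R))).
rewrite (@dstep_le0 _ (t + 1 - n.+1%:R)) => [|]; last by rewrite -natr1; lra.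
rewrite (@dstep_ge1 _ (t + 1 - 0%:R)) => [|]; last by lra.
rewrite oppr0 subr0 => H; rewrite -[RHS]H big_mkord; apply: eq_bigr => k _.
have -> : t + 1 - k.+1%:R = t - k%:R by rewrite -natr1; ring.
have -> : t + 1 - k%:R = t - k%:R + 1 by ring.
by rewrite /dbump opprK [RHS]addrC.
Qed.

Lemma dstep_le_itv (R : realType) (t : R) :
  dstep t <= 2 * ((0 < t)%R%:R - (0 < t - 1)%R%:R).
Proof.
rewrite subr_gt0; case: (lerP t 0) => t0.
  by rewrite dstep_le0// ltNge (le_trans t0)//= subrr mulr0.
case: (ltrP 1 t) => t1; first by rewrite dstep_ge1 ?subrr ?mulr0// ltW.
by rewrite subr0 mulr1; have /andP[] := dstep_bound t.
Qed.

(* [dbump] is dominated by a telescoping sum of Heaviside functions. *)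
Lemma sum_norm_dbump (R : realType) n (t : R) :
  \sum_(k < n) `|dbump (t - k%:R)| <= 4.
Proof.
pose G k : R := (0 < t + 1 - k%:R)%R%:R.
apply: le_trans (_ : \sum_(k < n) 2 * ((G k - G k.+1) + (G k.+1 - G k.+2)) <= _).
  apply: ler_sum => k _; rewrite /dbump mulrDr.
  apply: le_trans (ler_normB _ _) _.
  have e1 : t - k%:R + 1 = t + 1 - k%:R by ring.
  have e2 : t - k%:R = t + 1 - k.+1%:R by rewrite -natr1; ring.
  have e3 : t + 1 - k%:R - 1 = t + 1 - k.+1%:R by rewrite -natr1; ring.
  have e4 : t + 1 - k.+1%:R - 1 = t + 1 - k.+2%:R by rewrite -[k.+2%:R]natr1; ring.
  rewrite e1 e2 !ger0_norm ?(proj1 (andP (dstep_bound _)))//.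
  by apply: lerD; apply: le_trans (dstep_le_itv _) _; rewrite ?e3 ?e4 ?mulrBr.
rewrite -mulr_sumr big_split /=.
have T (H : nat -> R) : \sum_(k < n) (H k - H k.+1) = H 0%N - H n.
  rewrite -(big_mkord xpredT (fun k => H k - H k.+1)).
  rewrite -[RHS]opprB -(telescope_sumr H)//; rewrite -sumrN.
  by apply: eq_bigr => k _; rewrite opprB.
rewrite (T G) (T (fun k => G k.+1)).
have G01 k : 0 <= G k <= 1 by rewrite /G; case: (0 < _); rewrite ?lexx ?ler01.
have /andP[? ?] := G01 0%N; have /andP[? ?] := G01 1%N.
have /andP[? ?] := G01 n; have /andP[? ?] := G01 n.+1; lra.
Qed.

(** * Tensor products of bumps *)

Section Tensor.
Context {R : realType} {d : nat} (n : nat).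
Implicit Types (k : {ffun 'I_d -> 'I_n.+1}) (x : 'cV[R]_d).

Definition tbump k x : R := \prod_i bump (n%:R * x i 0 - (k i)%:R).
Definition dtbump k (j : 'I_d) x : R :=
  \prod_i (if i == j then n%:R * dbump (n%:R * x i 0 - (k i)%:R)
           else bump (n%:R * x i 0 - (k i)%:R)).

Definition node k : 'cV[R]_d := \col_i ((k i)%:R / n%:R).

Lemma tbump_ge0 k x : 0 <= tbump k x.
Proof. by apply: prodr_ge0 => i _; exact: bump_ge0. Qed.

Lemma tbump_neq0 k x : tbump k x != 0 ->
  forall i, `|n%:R * x i 0 - (k i)%:R| <= 1.
Proof.
move=> h i; rewrite leNgt; apply: contra_neqN h => h.
by rewrite /tbump (bigD1 i)//= bump_out ?mul0r// ltW.
Qed.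

Lemma dtbump_neq0 k j x : dtbump k j x != 0 ->
  forall i, `|n%:R * x i 0 - (k i)%:R| <= 1.
Proof.
move=> h i; rewrite leNgt; apply: contra_neqN h => h.
rewrite /dtbump (bigD1 i)//= bump_out ?(ltW h)// dbump_out ?(ltW h)//.
by rewrite mulr0 if_same mul0r.
Qed.

Lemma scaled_coord x i : cube R d x -> 0 <= n%:R * x i 0 <= n%:R.
Proof.
by move=> /(_ i)/andP[x0 x1]; rewrite mulr_ge0//= ler_piMr.
Qed.

(** By distributivity, a sum over multi-indices of products is the product of the one-dimensional
    sums. *)
Lemma sum_tbump x : cube R d x -> \sum_k tbump k x = 1.
Proof.
move=> xc; rewrite -(bigA_distr_bigA (fun i (a : 'I_n.+1) =>
  bump (n%:R * x i 0 - a%:R))).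
by rewrite big1// => i _; rewrite sum_bump ?scaled_coord.
Qed.

Lemma sum_dtbump x j : cube R d x -> \sum_k dtbump k j x = 0.
Proof.
move=> xc; rewrite -(bigA_distr_bigA (fun i (a : 'I_n.+1) =>
  if i == j then n%:R * dbump (n%:R * x i 0 - a%:R) else
  bump (n%:R * x i 0 - a%:R))).
by rewrite (bigD1 j)//= eqxx -mulr_sumr sum_dbump ?scaled_coord// mulr0 mul0r.
Qed.

(** After distributing, only the factor of index [j] carries a derivative; the other factors sum to
    1, so the bound is independent of the dimension. *)
Lemma sum_norm_dtbump x j : cube R d x ->
  \sum_k `|dtbump k j x| <= 4 * n%:R.
Proof.
move=> xc; under eq_bigr do rewrite normr_prod.
rewrite -(bigA_distr_bigA (fun i (a : 'I_n.+1) =>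
  `|if i == j then n%:R * dbump (n%:R * x i 0 - a%:R) else
  bump (n%:R * x i 0 - a%:R)|)).
rewrite (bigD1 j)//= eqxx [X in _ * X]big1 ?mulr1 => [|i ij]; last first.
  under eq_bigr do rewrite (negbTE ij) ger0_norm ?bump_ge0//.
  by rewrite sum_bump ?scaled_coord.
under eq_bigr do rewrite normrM normr_nat.
by rewrite -mulr_sumr mulrC ler_wpM2r// sum_norm_dbump.
Qed.

Lemma scaled_node k i : (0 < n)%N -> n%:R * node k i 0 = (k i)%:R.
Proof. by move=> n0; rewrite mxE mulrC divfK// pnatr_eq0 -lt0n. Qed.

Lemma tbump_node k l : (0 < n)%N -> tbump k (node l) = (k == l)%:R.
Proof.
move=> n0; rewrite /tbump; have [->|kl] := eqVneq k l.
  by rewrite big1// => i _; rewrite scaled_node// bump_nat eqxx.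
have [i kli] : exists i, k i != l i.
  by apply/existsP; rewrite -negb_forall; apply: contra kl => /forallP h;
     apply/eqP/ffunP => i; apply/eqP/h.
rewrite (bigD1 i)//= scaled_node// bump_nat eq_sym.
by have /negbTE -> : (k i != l i :> nat) by []; rewrite mul0r.
Qed.

Lemma dtbump_node k j l : (0 < n)%N -> dtbump k j (node l) = 0.
Proof.
move=> n0; rewrite /dtbump (bigD1 j)//= eqxx scaled_node// dbump_nat.
by rewrite mulr0 mul0r.
Qed.

Lemma C11_tbump k : C11 (tbump k) (dtbump k).
Proof.
apply: (C11_tensor (v := fun i t => bump (n%:R * t - (k i)%:R))
  (v' := fun i t => n%:R * dbump (n%:R * t - (k i)%:R))) => i.
have n0 : (0 : R) <= n%:R by [].
(* Each of the two steps contributes a constant 6, and scaling by n contributes at most two factors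
   n. *)
apply: (@C11_coord R d i (fun t => bump (n%:R * t - (k i)%:R))
  (fun t => n%:R * dbump (n%:R * t - (k i)%:R)) (12 * (1 + n%:R) ^+ 2)).
  by rewrite mulr_ge0// exprn_ge0// addr_ge0.
move=> s t _ _; rewrite /bump /dbump.
set a := n%:R * s - _; set b := n%:R * t - _.
have /andP[? ?] := step01 a; have /andP[? ?] := step01 (a + 1).
have /andP[? ?] := dstep_bound a; have /andP[? ?] := dstep_bound (a + 1).
have ba : b - a = n%:R * (t - s) by rewrite /a /b; ring.
have ba1 : b + 1 - (a + 1) = n%:R * (t - s) by rewrite -ba; ring.
have nE : `|n%:R * (t - s)| = n%:R * `|t - s| by rewrite normrM normr_nat.
have L1 := step_lip a b; have L2 := step_lip (a + 1) (b + 1).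
have L3 := dstep_lip a b; have L4 := dstep_lip (a + 1) (b + 1).
have T1 := step_taylor a b; have T2 := step_taylor (a + 1) (b + 1).
rewrite ba1 in L2 L4 T2; rewrite ba in L1 L3 T1; rewrite nE in L1 L2 L3 L4 T1 T2.
have D0 : 0 <= `|t - s| by []. move: `|t - s| D0 L1 L2 L3 L4 T1 T2 => D D0 *.
have nD : 0 <= n%:R * D by rewrite mulr_ge0.
have nnD : 0 <= n%:R * n%:R * D by rewrite !mulr_ge0.
have DD : 0 <= D * D by rewrite mulr_ge0.
have nDD : 0 <= n%:R * (D * D) by rewrite mulr_ge0.
have nn : 0 <= (n%:R : R) * n%:R by rewrite mulr_ge0.
split.
- by rewrite ler_norml; apply/andP; split; lra.
- rewrite normrM normr_nat.
  apply: le_trans (_ : n%:R * 2 <= _); last by lra.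
  by rewrite ler_wpM2l// ler_norml; apply/andP; split; lra.
- rewrite (_ : _ - _ = (step (b + 1) - step (a + 1)) - (step b - step a)); last by ring.
  by apply: le_trans (ler_normB _ _) _; lra.
- rewrite -mulrBr normrM normr_nat.
  apply: le_trans (_ : n%:R * (12 * (n%:R * D)) <= _); last by lra.
  rewrite ler_wpM2l//.
  rewrite (_ : _ - _ = (dstep (b + 1) - dstep (a + 1)) - (dstep b - dstep a)); last by ring.
  by apply: le_trans (ler_normB _ _) _; lra.
rewrite (_ : _ - _ = (step (b + 1) - step (a + 1) - dstep (a + 1) * (n%:R * (t - s)))
  - (step b - step a - dstep a * (n%:R * (t - s)))); last by ring.
by apply: le_trans (ler_normB _ _) _; lra.
Qed.

End Tensor.

(** * Spline quasi-interpolation *)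

Lemma C11_affine (R : realType) d (a : R) (b c : 'I_d -> R) :
  C11 (fun x : 'cV[R]_d => a + \sum_j b j * (x j 0 - c j)) (fun j _ => b j).
Proof.
pose K := `|a| + \sum_j `|b j| * (1 + `|c j|).
have S0 : 0 <= \sum_j `|b j| * (1 + `|c j|).
  by apply: sumr_ge0 => j _; rewrite mulr_ge0// addr_ge0.
have bK j : `|b j| <= K.
  rewrite /K (bigD1 j)//= mulrDr mulr1.
  have : 0 <= \sum_(i < d | i != j) `|b i| * (1 + `|c i|).
    by apply: sumr_ge0 => i _; rewrite mulr_ge0// addr_ge0.
  have : 0 <= `|b j| * `|c j| by rewrite mulr_ge0.
  by have : 0 <= `|a| by []; lra.
exists K; split=> [|x y xc yc]; first exact: addr_ge0.
have E : a + \sum_j b j * (y j 0 - c j) - (a + \sum_j b j * (x j 0 - c j)) =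
    \sum_j b j * (y j 0 - x j 0).
  rewrite opprD addrACA subrr add0r -sumrB; apply: eq_bigr => j _; ring.
split=> //.
- apply: le_trans (ler_normD _ _) _; rewrite lerD2l.
  apply: le_trans (ler_norm_sum _ _ _) _; apply: ler_sum => j _.
  rewrite normrM ler_wpM2l//; apply: le_trans (ler_normB _ _) _.
  by rewrite lerD2r; have /andP[x0 x1] := xc j; rewrite ger0_norm.
- rewrite E; apply: le_trans (ler_norm_sum _ _ _) _.
  rewrite /l1 mulr_sumr; apply: ler_sum => j _.
  by rewrite normrM !mxE ler_wpM2r.
- by move=> j; rewrite subrr normr0 mulr_ge0 ?l1_ge0// addr_ge0.
by rewrite E subrr normr0 mulr_ge0 ?exprn_ge0 ?l1_ge0// addr_ge0.
Qed.

(** The blend is polynomial only within a cell, whereas [net_zeros] treats functions polynomial on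
    the whole space; [P] is the extension from the rescaled cell. *)
Definition poly_on_cube (R : realType) d D (F : 'cV[R]_d -> R) : Prop :=
  exists P : 'cV[R]_d -> R, sepoly (fun=> D.+1) P /\
    forall y, cube R d y -> F y = P y.

Lemma poly_on_cube_le (R : realType) d D D' (F G : 'cV[R]_d -> R) :
  F =1 G -> (D <= D')%N -> poly_on_cube D F -> poly_on_cube D' G.
Proof.
move=> FG DD [P [hP PE]]; exists P; split; first exact: sepoly_le hP.
by move=> y yc; rewrite -FG PE.
Qed.

Lemma poly_on_cube_cst (R : realType) d (c : R) :
  poly_on_cube 0 (fun _ : 'cV[R]_d => c).
Proof. by exists (fun=> c); split=> //; exact: sepoly_cst. Qed.

Lemma poly_on_cubeD (R : realType) d D (F G : 'cV[R]_d -> R) :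
  poly_on_cube D F -> poly_on_cube D G -> poly_on_cube D (fun x => F x + G x).
Proof.
move=> [P [hP PE]] [Q [hQ QE]]; exists (fun x => P x + Q x); split.
  exact: sepolyD.
by move=> y yc; rewrite PE// QE.
Qed.

Lemma poly_on_cubeM (R : realType) d D D' (F G : 'cV[R]_d -> R) :
  poly_on_cube D F -> poly_on_cube D' G ->
  poly_on_cube (D + D') (fun x => F x * G x).
Proof.
move=> [P [hP PE]] [Q [hQ QE]]; exists (fun x => P x * Q x); split.
  exact: sepolyM.
by move=> y yc; rewrite PE// QE.
Qed.

Lemma poly_on_cube_sum (R : realType) d D (I : finType) (F : I -> 'cV[R]_d -> R) :
  (forall i, poly_on_cube D (F i)) -> poly_on_cube D (fun x => \sum_i F i x).
Proof.
move=> /choice[P h]; exists (fun x => \sum_i P i x); split.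
  by apply: sepoly_sum => i _; exact: (h i).1.
by move=> y yc; apply: eq_bigr => i _; exact: (h i).2.
Qed.

Lemma poly_on_cube_prod (R : realType) d D (I : finType) (F : I -> 'cV[R]_d -> R) :
  (forall i, poly_on_cube D (F i)) ->
  poly_on_cube (#|I| * D) (fun x => \prod_i F i x).
Proof.
move=> /choice[P h]; exists (fun x => \prod_i P i x); split.
  by apply: sepoly_prod => i; exact: (h i).1.
by move=> y yc; apply: eq_bigr => i _; exact: (h i).2.
Qed.

Lemma poly_on_cube_det (R : realType) d D m (A : 'cV[R]_d -> 'M[R]_m) :
  (forall i j, poly_on_cube D (fun x => A x i j)) ->
  poly_on_cube (m * D) (fun x => \det (A x)).
Proof.
move=> h.
apply: (poly_on_cube_sum (F := fun (s : 'S_m) x => (-1) ^+ s * \prod_i A x i (s i))) => s.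
apply: (@poly_on_cube_le _ _ (0 + #|'I_m| * D) _
  (fun x => (-1) ^+ s * \prod_i A x i (s i))) => //; first by rewrite card_ord.
apply: poly_on_cubeM; first exact: poly_on_cube_cst.
exact: (poly_on_cube_prod (F := fun i x => A x i (s i))).
Qed.

Lemma poly_on_cube_coord (R : realType) d i (p : {poly R}) D (v : R -> R) :
  (size p <= D.+1)%N -> (forall t, 0 <= t <= 1 -> v t = p.[t]) ->
  poly_on_cube D (fun x : 'cV[R]_d => v (x i 0)).
Proof.
move=> sp pE; exists (fun x => p.[x i 0]); split; last first.
  by move=> y yc; rewrite pE.
move=> j x; have [<-|ij] := eqVneq i j.
  by exists p; split=> // t; rewrite upd_same.
exists (p.[x i 0])%:P; split; first by rewrite size_polyC (leq_trans (leq_b1 _)).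
by move=> t; rewrite upd_other// hornerC.
Qed.

Lemma step_cell (R : realType) (a k : nat) : exists p : {poly R},
  (size p <= 4)%N /\ forall t, 0 <= t <= 1 -> step (a%:R + t - k%:R) = p.[t].
Proof.
have [ak|ak|<-] := ltngtP a k.
- exists 0; rewrite size_poly0; split=> // t /andP[t0 t1].
  rewrite horner0 step_le0//.
  have h : a.+1%:R <= (k%:R : R) by rewrite ler_nat.
  by rewrite -natr1 in h; lra.
- exists 1; rewrite size_poly1; split=> // t /andP[t0 t1].
  rewrite hornerC step_ge1//.
  have h : k.+1%:R <= (a%:R : R) by rewrite ler_nat.
  by rewrite -natr1 in h; lra.
exists ('X^2 * (3%:P - 2%:P * 'X)); split.
  apply: leq_trans (size_polyMleq _ _) _; rewrite size_polyXn.
  rewrite -subn1 leq_subLR add1n addSnnS !addSn add0n !ltnS.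
  apply: leq_trans (size_polyD _ _) _; rewrite geq_max size_polyN.
  rewrite (leq_trans (size_polyC_leq1 _))//=.
  by rewrite mul_polyC (leq_trans (size_scale_leq _ _))// size_polyX.
by move=> t ht; rewrite addrC addKr step_in// !hornerE.
Qed.

Lemma dstep_cell (R : realType) (a k : nat) : exists p : {poly R},
  (size p <= 4)%N /\ forall t, 0 <= t <= 1 -> dstep (a%:R + t - k%:R) = p.[t].
Proof.
have [ak|ak|<-] := ltngtP a k.
- exists 0; rewrite size_poly0; split=> // t /andP[t0 t1].
  rewrite horner0 dstep_le0//.
  have h : a.+1%:R <= (k%:R : R) by rewrite ler_nat.
  by rewrite -natr1 in h; lra.
- exists 0; rewrite size_poly0; split=> // t /andP[t0 t1].
  rewrite horner0 dstep_ge1//.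
  have h : k.+1%:R <= (a%:R : R) by rewrite ler_nat.
  by rewrite -natr1 in h; lra.
exists ('X * (6%:P - 6%:P * 'X)); split.
  apply: leq_trans (size_polyMleq _ _) _; rewrite size_polyX.
  rewrite -subn1 leq_subLR add1n !addSn add0n !ltnS.
  apply: leq_trans (size_polyD _ _) _; rewrite geq_max size_polyN.
  rewrite (leq_trans (size_polyC_leq1 _))//=.
  by rewrite mul_polyC (leq_trans (size_scale_leq _ _))// size_polyX.
by move=> t ht; rewrite addrC addKr dstep_in// !hornerE; ring.
Qed.

Section Interpolant.
Context {R : realType} {d : nat} (n : nat).
Implicit Types (k : {ffun 'I_d -> 'I_n.+1}) (x : 'cV[R]_d).
Variables (a : {ffun 'I_d -> 'I_n.+1} -> R)
  (b : {ffun 'I_d -> 'I_n.+1} -> 'I_d -> R).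

Definition taylor k x : R := a k + \sum_j b k j * (x j 0 - node k j 0).
Definition interp x : R := \sum_k tbump k x * taylor k x.
Definition dinterp (j : 'I_d) x : R :=
  \sum_k (tbump k x * b k j + dtbump k j x * taylor k x).

Lemma C11_interp : C11 interp dinterp.
Proof.
apply: (@C11_sum R d _ (index_enum _) (fun k x => tbump k x * taylor k x)
 (fun k j x => tbump k x * b k j + dtbump k j x * taylor k x)) => k.
exact: C11M (C11_tbump k) (C11_affine (a k) (b k) (fun j => node k j 0)).
Qed.

Lemma dinterp_node j l : (0 < n)%N -> dinterp j (node l) = b l j.
Proof.
move=> n0; rewrite /dinterp (bigD1 l)//= big1 ?addr0 => [|k kl].
  by rewrite tbump_node// dtbump_node// eqxx mul0r addr0 mul1r.
by rewrite tbump_node// dtbump_node// (negbTE kl) !mul0r addr0.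
Qed.

(** Since the bumps sum to 1 and their derivatives to 0, [u] may be subtracted inside both sums. The
    derivatives of the bumps then multiply only the small differences [taylor k x - u], at the cost
    of 4n. *)
Lemma interp_error x (u : R) (w : 'I_d -> R) (eta theta : R) :
  cube R d x -> 0 <= eta ->
  (forall k, (forall i, `|n%:R * x i 0 - (k i)%:R| <= 1) ->
     `|taylor k x - u| <= eta /\ forall j, `|b k j - w j| <= theta) ->
  `|interp x - u| <= eta /\
  forall j, `|dinterp j x - w j| <= theta + 4 * n%:R * eta.
Proof.
move=> xc eta0 h; have h1 k : tbump k x * `|taylor k x - u| <= tbump k x * eta.
  have [->|/tbump_neq0/h[+ _]] := eqVneq (tbump k x) 0; first by rewrite !mul0r.
  by apply: ler_wpM2l; exact: tbump_ge0.
have h2 k j : tbump k x * `|b k j - w j| <= tbump k x * theta.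
  have [->|/tbump_neq0/h[_ /(_ j)]] := eqVneq (tbump k x) 0; first by rewrite !mul0r.
  by apply: ler_wpM2l; exact: tbump_ge0.
have h3 k j : `|dtbump k j x| * `|taylor k x - u| <= `|dtbump k j x| * eta.
  have [->|/dtbump_neq0/h[+ _]] := eqVneq (dtbump k j x) 0.
    by rewrite normr0 !mul0r.
  exact: ler_wpM2l.
split.
  have -> : interp x - u = \sum_k tbump k x * (taylor k x - u).
    under eq_bigr do rewrite mulrBr.
    by rewrite sumrB -mulr_suml (sum_tbump n xc) mul1r.
  apply: le_trans (ler_norm_sum _ _ _) _.
  rewrite -[leRHS]mul1r -(sum_tbump n xc) mulr_suml; apply: ler_sum => k _.
  by rewrite normrM (ger0_norm (tbump_ge0 k x)).
move=> j.
have -> : dinterp j x - w j = \sum_k (tbump k x * (b k j - w j)) +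
    \sum_k dtbump k j x * (taylor k x - u).
  under eq_bigr do rewrite mulrBr.
  under [X in _ = _ + X]eq_bigr do rewrite mulrBr.
  rewrite !sumrB -!mulr_suml (sum_tbump n xc) (sum_dtbump n j xc).
  by rewrite mul0r mul1r subr0 /dinterp big_split /= addrAC.
apply: le_trans (ler_normD _ _) _; apply: lerD.
  apply: le_trans (ler_norm_sum _ _ _) _.
  rewrite -[leRHS]mul1r -(sum_tbump n xc) mulr_suml; apply: ler_sum => k _.
  by rewrite normrM (ger0_norm (tbump_ge0 k x)).
apply: le_trans (ler_norm_sum _ _ _) _.
apply: le_trans (_ : (\sum_k `|dtbump k j x|) * eta <= _).
  by rewrite mulr_suml; apply: ler_sum => k _; rewrite normrM.
by rewrite ler_wpM2r// sum_norm_dtbump.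
Qed.

Definition cell_point (l : {ffun 'I_d -> 'I_n}) (y : 'cV[R]_d) : 'cV[R]_d :=
  \col_i (((l i)%:R + y i 0) / n%:R).

(** The degree counts d cubic factors, one per coordinate, and one affine Taylor polynomial. *)
Lemma poly_dinterp_cell (l : {ffun 'I_d -> 'I_n}) j : (0 < n)%N ->
  poly_on_cube (d * 3 + 1) (fun y => dinterp j (cell_point l y)).
Proof.
move=> n0; have nn0 : (n%:R : R) != 0 by rewrite pnatr_eq0 -lt0n.
have sc y i : n%:R * cell_point l y i 0 = (l i)%:R + y i 0.
  by rewrite mxE mulrC divfK.
have hb k i : poly_on_cube 3 (fun y : 'cV[R]_d =>
    bump (n%:R * cell_point l y i 0 - (k i)%:R)).
  have [p [sp pE]] := step_cell R (l i).+1 (k i).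
  have [q [sq qE]] := step_cell R (l i) (k i).
  have := @poly_on_cube_coord R d i (p - q) 3
     (fun t => bump ((l i)%:R + t - (k i)%:R)).
  case=> [||P [hP PE]].
  - by apply: leq_trans (size_polyD _ _) _; rewrite geq_max size_polyN sp.
  - move=> t ht; rewrite hornerD hornerN -pE// -qE// /bump -natr1.
    by congr (step _ - _); ring.
  by exists P; split=> // y yc; rewrite sc PE.
have hd k i : poly_on_cube 3 (fun y : 'cV[R]_d =>
    n%:R * dbump (n%:R * cell_point l y i 0 - (k i)%:R)).
  have [p [sp pE]] := dstep_cell R (l i).+1 (k i).
  have [q [sq qE]] := dstep_cell R (l i) (k i).
  have := @poly_on_cube_coord R d i (n%:R *: (p - q)) 3
     (fun t => n%:R * dbump ((l i)%:R + t - (k i)%:R)).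
  case=> [||P [hP PE]].
  - apply: leq_trans (size_scale_leq _ _) _.
    by apply: leq_trans (size_polyD _ _) _; rewrite geq_max size_polyN sp.
  - move=> t ht; rewrite hornerZ hornerD hornerN -pE// -qE// /dbump -natr1.
    by congr (_ * (dstep _ - _)); ring.
  by exists P; split=> // y yc; rewrite sc PE.
have ht k : poly_on_cube 1 (fun y => taylor k (cell_point l y)).
  apply: poly_on_cubeD; first by apply: poly_on_cube_le (poly_on_cube_cst _ _).
  apply: (poly_on_cube_sum (F := fun i y => b k i * (cell_point l y i 0 - node k i 0))).
  move=> i; apply: (@poly_on_cube_le _ _ (0 + 1) _
    (fun y => b k i * (cell_point l y i 0 - node k i 0))) => //.
  apply: poly_on_cubeM; first exact: poly_on_cube_cst.
  have := @poly_on_cube_coord R d i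
    (n%:R^-1 *: 'X + ((l i)%:R / n%:R - node k i 0)%:P) 1
    (fun t => ((l i)%:R + t) / n%:R - node k i 0).
  case=> [||P [hP PE]].
  - apply: leq_trans (size_polyD _ _) _; rewrite geq_max.
    rewrite (leq_trans (size_scale_leq _ _)) ?size_polyX//=.
    by rewrite (leq_trans (size_polyC_leq1 _)).
  - by move=> t _; rewrite hornerD hornerZ hornerX hornerC; move: (n%:R^-1) (node k i 0) => u v; ring.
  by exists P; split=> // y yc; rewrite mxE PE.
apply: (poly_on_cube_sum (F := fun k y => tbump k (cell_point l y) * b k j +
   dtbump k j (cell_point l y) * taylor k (cell_point l y))) => k.
apply: poly_on_cubeD.
  apply: (@poly_on_cube_le _ _ (d * 3 + 0) _
    (fun y => tbump k (cell_point l y) * b k j)) => //; first by rewrite leq_add2l.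
  apply: poly_on_cubeM; last exact: poly_on_cube_cst.
  rewrite -[X in (X * 3)%N](card_ord d).
  exact: (poly_on_cube_prod (F := fun i y => bump (n%:R * cell_point l y i 0 - (k i)%:R))).
apply: poly_on_cubeM; last exact: ht.
rewrite -[X in (X * 3)%N](card_ord d).
apply: (poly_on_cube_prod (F := fun i y =>
   if i == j then n%:R * dbump (n%:R * cell_point l y i 0 - (k i)%:R)
   else bump (n%:R * cell_point l y i 0 - (k i)%:R))) => i.
by case: eqP.
Qed.

End Interpolant.

(** * Taylor bound for Hölder Jacobians *)

(** Passes from an expansion relative to the segment to the two-sided derivative in which [MVT] is
    phrased. *)
Lemma is_derive_within (R : realType) (phi : R -> R) (t D a b : R) :
  a < t < b ->
  (forall eps : R, 0 < eps -> exists2 delta : R, 0 < delta &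
     forall s, a <= s <= b -> `|s - t| < delta ->
       `|phi s - phi t - (s - t) * D| <= eps * `|s - t|) ->
  is_derive t 1 phi D.
Proof.
move=> /andP[at_ tb] h.
have cv : h^-1 *: ((phi \o shift t) (h *: 1) - phi t) @[h --> 0^'] --> D.
  apply/cvgrPdist_le => eps eps0; have [delta d0 hd] := h eps eps0.
  have m0 : 0 < Num.min delta (Num.min (t - a) (b - t)).
    by rewrite !lt_min d0 !subr_gt0 at_ tb.
  apply/nbhs_ballP; exists (Num.min delta (Num.min (t - a) (b - t))) => // u.
  rewrite /ball /= sub0r normrN !lt_min => /and3P[u1 u2 u3] u0.
  have hs : a <= u + t <= b.
    by move: u2 u3; rewrite !ltr_norml => /andP[? ?] /andP[? ?]; apply/andP; split; lra.
  have := hd (u + t) hs; rewrite addrK => /(_ u1) H.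
  rewrite /shift /= [u *: 1]mulr1 distrC.
  have -> : u^-1 *: (phi (u + t) - phi t) - D = u^-1 * (phi (u + t) - phi t - u * D).
    by rewrite [_ *: _]/(_ * _) mulrBr mulrA mulVf// mul1r.
  by rewrite normrM normfV mulrC ler_pdivrMr ?normr_gt0.
apply: DeriveDef; first exact: cvgP cv.
exact: cvg_lim cv.
Qed.

Lemma continuous_within_itv (R : realType) (phi : R -> R) (a b : R) :
  (forall t, a <= t <= b -> exists2 K : R, 0 <= K & exists2 delta : R, 0 < delta &
     forall s, a <= s <= b -> `|s - t| < delta ->
       `|phi s - phi t| <= K * `|s - t|) ->
  {within `[a, b], continuous phi}.
Proof.
move=> h; apply/subspace_continuousP => t; rewrite /= in_itv /= => tab.
have [K K0 [delta d0 hd]] := h t tab.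
apply/cvgrPdist_le => eps eps0.
have e0 : 0 < eps / (K + 1) by rewrite divr_gt0// ltr_wpDl.
apply/nbhs_ballP; exists (Num.min delta (eps / (K + 1))); first by rewrite /= lt_min d0.
move=> s; rewrite /ball /= lt_min distrC => /andP[s1 s2].
rewrite in_itv /= => sab; rewrite distrC; apply: le_trans (hd s sab s1) _.
apply: le_trans (_ : (K + 1) * `|s - t| <= _); first by rewrite ler_wpM2r// lerDl.
by rewrite mulrC -ler_pdivlMr ?ltr_wpDl// ltW.
Qed.

(** Along the segment from [x] to [y], the mean value theorem gives the increment as the Jacobian at
    an intermediate point applied to y - x; the Hölder bound compares it with the Jacobian at [x].
    The length of the segment is at most d * r. *)
Lemma taylor_holder (R : realType) d m (f : 'cV[R]_d -> 'cV[R]_m) alpha H :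
  C1 f -> 0 < alpha -> 0 <= H ->
  (forall x y, cube R d x -> cube R d y -> x <> y ->
     opnorm (jac f x - jac f y) <= H * enorm (x - y) `^ alpha) ->
  forall x y r, 0 <= r -> cube R d x -> cube R d y ->
    (forall j, `|y j 0 - x j 0| <= r) -> forall i,
    (forall j, `|jac f y i j - jac f x i j| <= H * (d%:R * r) `^ alpha) /\
    `|f y i 0 - f x i 0 - \sum_j jac f x i j * (y j 0 - x j 0)| <=
      d%:R * (H * (d%:R * r) `^ alpha) * r.
Proof.
move=> fC1 alpha0 H0 hol.
have lip x y r : 0 <= r -> cube R d x -> cube R d y ->
    (forall j, `|y j 0 - x j 0| <= r) -> forall i j,
    `|jac f y i j - jac f x i j| <= H * (d%:R * r) `^ alpha.
  move=> r0 xc yc yx i j.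
  have [->|/eqP nyx] := eqVneq y x.
    by rewrite subrr normr0 mulr_ge0// powR_ge0.
  have := entry_le_opnorm (jac f y - jac f x) i j; rewrite !mxE => /le_trans; apply.
  apply: le_trans (hol _ _ yc xc nyx) _; apply: ler_wpM2l => //.
  apply: ge0_ler_powR; rewrite ?nnegrE ?enorm_ge0 ?mulr_ge0//; first exact: ltW.
  by apply: enorm_le_max => k; rewrite !mxE.
move=> x y r r0 xc yc yx i; split; first by move=> j; exact: lip.
pose z (t : R) : 'cV[R]_d := \col_j (x j 0 + t * (y j 0 - x j 0)).
have zc t : 0 <= t <= 1 -> cube R d (z t).
  move=> /andP[t0 t1] j; rewrite mxE.
  have /andP[x0 x1] := xc j; have /andP[y0 y1] := yc j.
  have -> : x j 0 + t * (y j 0 - x j 0) = (1 - t) * x j 0 + t * y j 0 by ring.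
  have t1' : 0 <= 1 - t by lra.
  have x1' : 0 <= 1 - x j 0 by lra.
  have y1' : 0 <= 1 - y j 0 by lra.
  have := mulr_ge0 t1' x0; have := mulr_ge0 t0 y0.
  have := mulr_ge0 t1' x1'; have := mulr_ge0 t0 y1'.
  by move=> *; apply/andP; split; lra.
have zB s t j : z s j 0 - z t j 0 = (s - t) * (y j 0 - x j 0).
  by rewrite !mxE; ring.
pose phi t := f (z t) i 0.
pose D t := \sum_j jac f (z t) i j * (y j 0 - x j 0).
pose L := l1 (y - x).
have L0 : 0 <= L by exact: l1_ge0.
(* The segment may lie in a face of the cube. By convexity it stays in the cube, so the relative
   Jacobian applies. *)
have key t : 0 <= t <= 1 -> forall eps : R, 0 < eps -> exists2 delta : R, 0 < delta &
     forall s, 0 <= s <= 1 -> `|s - t| < delta ->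
       `|phi s - phi t - (s - t) * D t| <= eps * `|s - t|.
  move=> ht eps eps0.
  have e0 : 0 < eps / (L + 1) by rewrite divr_gt0// ltr_wpDl.
  have /has_jacobianP/(_ _ e0)[delta d0 hd] := has_jacobian_jac fC1 (zc t ht).
  exists (delta / (r + 1)); first by rewrite divr_gt0// ltr_wpDl.
  move=> s hs st; have := hd (z s) (zc s hs).
  have near j : `|z s j 0 - z t j 0| < delta.
    rewrite zB normrM.
    apply: le_lt_trans (_ : `|s - t| * (r + 1) < _).
      by rewrite ler_wpM2l// (le_trans (yx j))// lerDl.
    by rewrite -ltr_pdivlMr// ltr_wpDl.
  move=> /(_ near i).
  have -> : \sum_j jac f (z t) i j * (z s j 0 - z t j 0) = (s - t) * D t.
    rewrite /D mulr_sumr; apply: eq_bigr => j _; rewrite zB; ring.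
  have -> : l1 (z s - z t) = `|s - t| * L.
    rewrite /l1 /L mulr_sumr; apply: eq_bigr => j _.
    by rewrite -normrM -[X in `|_ * X|]/((y - x) j 0) !mxE; congr `|_|; ring.
  move=> /le_trans; apply.
  rewrite mulrCA [leRHS]mulrC ler_wpM2l// mulrAC.
  by rewrite ler_pdivrMr ?ltr_wpDl//; apply: ler_wpM2l; [exact: ltW|lra].
have [c c01 cE] : exists2 c, c \in `]0, 1[%R & phi 1 - phi 0 = D c * (1 - 0).
  apply: MVT => //.
    move=> t; rewrite in_itv /= => ht; apply: (is_derive_within ht).
    by apply: key; case/andP: ht => *; rewrite !ltW.
  apply: continuous_within_itv => t ht; exists (1 + `|D t|); first exact: addr_ge0.
  have [delta d0 hd] := key t ht 1 ltr01; exists delta => // s hs st.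
  have -> : phi s - phi t = (phi s - phi t - (s - t) * D t) + (s - t) * D t by ring.
  apply: le_trans (ler_normD _ _) _.
  by rewrite [leRHS]mulrDl lerD// ?hd// normrM [leLHS]mulrC.
have z0 : z 0 = x by apply/colP => j; rewrite mxE mul0r addr0.
have z1 : z 1 = y by apply/colP => j; rewrite mxE; ring.
move: cE; rewrite /phi z0 z1 subr0 mulr1 => ->.
rewrite /D -sumrB; apply: le_trans (ler_norm_sum _ _ _) _.
move: c01; rewrite in_itv /= => /andP[c0 c1].
have c01 : 0 <= c <= 1 by rewrite !ltW.
have -> : d%:R * (H * (d%:R * r) `^ alpha) * r =
    \sum_(j < d) (H * (d%:R * r) `^ alpha) * r.
  by rewrite sumr_const card_ord -[RHS]mulr_natl [RHS]mulrA.
apply: ler_sum => j _; rewrite -mulrBl normrM; apply: ler_pM => //.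
apply: lip => // [|k]; first exact: zc.
have -> : z c k 0 - x k 0 = c * (y k 0 - x k 0) by rewrite !mxE; ring.
rewrite normrM ger0_norm ?(ltW c0)//; apply: le_trans (yx k).
by rewrite ler_piMl// ltW.
Qed.

(** * The perturbed approximation *)

Lemma poly_nonroot (R : realType) (p : {poly R}) (tau : R) :
  p != 0 -> 0 < tau -> exists2 t, 0 < t < tau & p.[t] != 0.
Proof.
move=> p0 tau0; apply: contrapT => h.
(* As many distinct points of (0, tau) as the size of [p], one more than [p] can have roots. *)
pose s := [seq tau / (i.+2)%:R | i <- iota 0 (size p)].
have : (size s < size p)%N.
  apply: max_poly_roots p0 _ _.
    apply/allP => t /mapP[i _ ->]; apply: contrapT => /negP ri; apply: h.
    exists (tau / i.+2%:R) => //; rewrite divr_gt0//= ltr_pdivrMr//.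
    by rewrite ltr_pMr// ltr1n.
  rewrite map_inj_uniq ?iota_uniq// => i j /(mulfI (lt0r_neq0 tau0))/invr_inj.
  by move/eqP; rewrite eqr_nat => /eqP [].
by rewrite size_map size_iota ltnn.
Qed.

(** As a function of t, the determinant is the characteristic polynomial of -A, which is monic; a
    finite product of such polynomials is nonzero and has a nonroot below [tau]. *)
Lemma nonsingular_shift (R : realType) m (I : finType) (A : I -> 'M[R]_m)
    (tau : R) :
  0 < tau -> exists2 t, 0 < t < tau & forall k, \det (A k + t%:M) != 0.
Proof.
move=> tau0.
have p0 : \prod_k char_poly (- A k) != 0.
  by apply/prodf_neq0 => k _; rewrite monic_neq0// char_poly_monic.
have [t ht] := poly_nonroot p0 tau0.
rewrite horner_prod => /prodf_neq0 h; exists t => // k.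
have := h k isT; rewrite /char_poly -horner_evalE -det_map_mx; congr (\det _ != 0).
apply/matrixP => i j; rewrite !mxE -[LHS]/((_).[t]) hornerD hornerN hornerMn hornerX hornerC.
by rewrite opprK addrC.
Qed.

Lemma cell_pointK (R : realType) d n (l : {ffun 'I_d -> 'I_n}) (x : 'cV[R]_d) :
  (0 < n)%N -> cell_point l (cell_coord l x) = x.
Proof.
move=> n0; apply/colP => i; rewrite !mxE addrC subrK mulrC mulKf//.
by rewrite pnatr_eq0 -lt0n.
Qed.

Lemma node_cube (R : realType) d n (k : {ffun 'I_d -> 'I_n.+1}) :
  (0 < n)%N -> cube R d (node k).
Proof.
move=> n0 j; rewrite mxE divr_ge0//= ler_pdivrMr ?ltr0n// mul1r ler_nat.
by rewrite -ltnS.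
Qed.

(** The minor is [A] times a matrix selecting the first m columns, so its rank is at most that of
    [A]. *)
Lemma rank_det0 (R : realType) m d (hmd : (m <= d)%N) (A : 'M[R]_(m, d)) :
  (\rank A < m)%N -> \det (\matrix_(i, j) A i (widen_ord hmd j)) = 0.
Proof.
move=> rA; apply/eqP; apply: contraTT rA => detA; rewrite -leqNgt.
have E : (\matrix_(i, j) A i (widen_ord hmd j)) =
    A *m (\matrix_(k, j) (k == widen_ord hmd j)%:R).
  apply/matrixP => i j; rewrite !mxE (bigD1 (widen_ord hmd j))//= big1.
    by rewrite mxE eqxx mulr1 addr0.
  by move=> k /negbTE kj; rewrite mxE kj mulr0.
rewrite E in detA; have := mxrankM_maxl A (\matrix_(k, j) (k == widen_ord hmd j)%:R).
by rewrite [X in (X <= _)%N -> _]mxrank_unit// unitmxE unitfE.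
Qed.

Section Approximation.
Context {R : realType} {d m : nat} (n : nat) (t : R).
Variables (hmd : (m <= d)%N) (f : 'cV[R]_d -> 'cV[R]_m).

Let a i (k : {ffun 'I_d -> 'I_n.+1}) := f (node k) i 0.
Let b i (k : {ffun 'I_d -> 'I_n.+1}) j := jac f (node k) i j.

(** The added linear map is t times the projection to the first m coordinates, which adds the scalar
    matrix t to the leading minor. *)
Definition approx (x : 'cV[R]_d) : 'cV[R]_m :=
  \col_i (interp (a i) (b i) x + t * x (widen_ord hmd i) 0).

Definition dapprox (x : 'cV[R]_d) : 'M[R]_(m, d) :=
  \matrix_(i, j) (dinterp (a i) (b i) j x + t * (widen_ord hmd i == j)%:R).

Definition dapprox_minor (x : 'cV[R]_d) : 'M[R]_m :=
  \matrix_(i, j) dapprox x i (widen_ord hmd j).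

Lemma approx_C1 :
  (forall x, cube R d x -> has_jacobian approx x (dapprox x)) /\ C1 approx.
Proof.
apply: C11_C1 => i; apply: (C11_ext (u := fun x =>
   interp (a i) (b i) x + t * x (widen_ord hmd i) 0)
  (w := fun j x => dinterp (a i) (b i) j x + t * (widen_ord hmd i == j)%:R)).
- by move=> x; rewrite mxE.
- by move=> j x; rewrite mxE.
apply: C11D; first exact: C11_interp.
apply: C11_ext (C11_affine 0 (fun j => t * (widen_ord hmd i == j)%:R) (fun=> 0)).
  move=> x; rewrite add0r (bigD1 (widen_ord hmd i))//= eqxx mulr1 subr0 big1 ?addr0//.
  by move=> j ji; rewrite eq_sym (negbTE ji) mulr0 mul0r.
by [].
Qed.

Lemma dapprox_minor_node (l : {ffun 'I_d -> 'I_n.+1}) : (0 < n)%N ->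
  dapprox_minor (node l) =
  (\matrix_(i, j) jac f (node l) i (widen_ord hmd j)) + t%:M.
Proof.
move=> n0; apply/matrixP => i j; rewrite !mxE dinterp_node// /b.
by rewrite -[widen_ord hmd i == _]/(i == j) mulr_natr.
Qed.

(** The determinant has degree m (3d + 1); replacing m by d makes the final constant independent of
    m. *)
Lemma poly_minor_cell (l : {ffun 'I_d -> 'I_n}) : (0 < n)%N ->
  poly_on_cube (d * (d * 3 + 1)) (fun y => \det (dapprox_minor (cell_point l y))).
Proof.
move=> n0; apply: (@poly_on_cube_le _ _ (m * (d * 3 + 1)) _
  (fun y => \det (dapprox_minor (cell_point l y)))) => //; first by rewrite leq_mul2r hmd orbT.
apply: (poly_on_cube_det (A := fun y => dapprox_minor (cell_point l y))) => i j.
apply: (@poly_on_cube_le _ _ (d * 3 + 1) _ (fun y =>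
  dinterp (a i) (b i) (widen_ord hmd j) (cell_point l y) +
  t * (widen_ord hmd i == widen_ord hmd j)%:R)) => //.
  by move=> y; rewrite !mxE.
apply: poly_on_cubeD; first exact: poly_dinterp_cell.
by apply: poly_on_cube_le (poly_on_cube_cst _ _).
Qed.

(** The Jacobian is compared with that of [f] after the shift, so its error is a multiple of H
    alone; for H = 0 this becomes an equality. The 5 is 1 from the variation of the Jacobian plus 4
    from the derivatives of the bumps. *)
Lemma approx_error (alpha H : R) : (0 < n)%N -> 0 < t ->
  C1 f -> 0 < alpha -> 0 <= H ->
  (forall x y, cube R d x -> cube R d y -> x <> y ->
     opnorm (jac f x - jac f y) <= H * enorm (x - y) `^ alpha) ->
  let B := H * (d%:R / n%:R) `^ alpha in
  forall x, cube R d x ->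
    (forall i, `|approx x i 0 - f x i 0| <= d%:R * B + t) /\
    (forall i j, `|dapprox x i j - (jac f x i j + t * (widen_ord hmd i == j)%:R)|
       <= 5 * d%:R * B).
Proof.
move=> n0 t0 fC1 alpha0 H0 hol B x xc.
have nn0 : (0 : R) < n%:R by rewrite ltr0n.
have B0 : 0 <= B by rewrite mulr_ge0 ?powR_ge0.
have eta0 : 0 <= d%:R * B / n%:R by rewrite divr_ge0 ?mulr_ge0.
have err i : `|interp (a i) (b i) x - f x i 0| <= d%:R * B / n%:R /\
    forall j, `|dinterp (a i) (b i) j x - jac f x i j| <=
      B + 4 * n%:R * (d%:R * B / n%:R).
  apply: interp_error => // k hk.
  have xk j : `|x j 0 - node k j 0| <= n%:R^-1.
    rewrite mxE -(ler_pM2l nn0) divff ?gt_eqF//.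
    rewrite -{1}[n%:R]gtr0_norm// -normrM mulrBr mulrCA divff ?gt_eqF// mulr1.
    exact: hk.
  have kx j : `|node k j 0 - x j 0| <= n%:R^-1 by rewrite distrC.
  have n1 : 0 <= (n%:R : R)^-1 by rewrite invr_ge0.
  split; last first.
    have [+ _] := taylor_holder fC1 alpha0 H0 hol n1 xc (node_cube R k n0) kx i.
    by [].
  have [_ T] := taylor_holder fC1 alpha0 H0 hol n1 (node_cube R k n0) xc xk i.
  by rewrite -normrN opprB /taylor opprD addrA.
(* An index in ['I_m] witnesses 0 < m <= d. *)
have d1 (i : 'I_m) : 1 <= d%:R :> R.
  by rewrite ler1n (leq_trans _ hmd)// (leq_ltn_trans _ (ltn_ord i)).
have n1 : 1 <= n%:R :> R by rewrite ler1n.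
split=> [i|i j]; rewrite mxE.
  rewrite addrAC; apply: le_trans (ler_normD _ _) _; apply: lerD.
    apply: le_trans (err i).1 _; rewrite ler_pdivrMr//.
    by rewrite ler_peMr// mulr_ge0.
  have /andP[x0 x1] := xc (widen_ord hmd i).
  by rewrite ger0_norm ?mulr_ge0 ?(ltW t0)// ler_piMr// ltW.
rewrite opprD addrACA subrr addr0; apply: le_trans ((err i).2 j) _.
rewrite (_ : 4 * _ * _ = 4 * (d%:R * B)); last by field; rewrite gt_eqF.
by have : B <= d%:R * B; [rewrite ler_peMl// (d1 i)|clear d1; lra].
Qed.

Lemma approx_C1norm (alpha H : R) : (0 < n)%N -> 0 < t -> (0 < d)%N ->
  C1 f -> 0 < alpha -> 0 <= H ->
  (forall x y, cube R d x -> cube R d y -> x <> y ->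
     opnorm (jac f x - jac f y) <= H * enorm (x - y) `^ alpha) ->
  (C1norm (approx \- f)%R <=
   (6 * d%:R ^+ 3 * (H * (d%:R / n%:R) `^ alpha) + 2 * d%:R ^+ 2 * t)%:E)%E.
Proof.
move=> n0 t0 d0 fC1 alpha0 H0 hol; set B := H * _.
have B0 : 0 <= B by rewrite mulr_ge0 ?powR_ge0.
have err := approx_error n0 t0 fC1 alpha0 H0 hol; rewrite -/B in err.
have d1 : 1 <= d%:R :> R by rewrite ler1n.
have md : m%:R <= d%:R :> R by rewrite ler_nat.
have dd : d%:R <= d%:R ^+ 2 :> R by rewrite expr2 ler_peMl.
have dB : d%:R * d%:R * B <= d%:R ^+ 3 * B.
  by rewrite ler_wpM2r// exprS mulrC -expr2 ler_peMl// exprn_ge0.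
apply: (@le_trans _ _ ((m%:R * (d%:R * B + t))%:E +
    (m%:R * (d%:R * (5 * d%:R * B + t)))%:E)%E); last first.
  rewrite -EFinD lee_fin.
  apply: le_trans (_ : d%:R * (d%:R * B + t) + d%:R * (d%:R * (5 * d%:R * B + t)) <= _).
    have h1 : 0 <= d%:R * B by rewrite mulr_ge0.
    have h2 : 0 <= d%:R * (5 * d%:R * B + t).
      by rewrite mulr_ge0// addr_ge0 ?(ltW t0)// !mulr_ge0.
    by apply: lerD; apply: ler_wpM2r => //; rewrite addr_ge0 ?(ltW t0).
  have dt : d%:R * t <= d%:R ^+ 2 * t by rewrite ler_wpM2r// ltW.
  lra.
apply: leeD; apply: ge_ereal_sup => _ [x xc <-]; rewrite lee_fin.
  by apply: enorm_le_max => i; rewrite !mxE -/(approx _ _ _); have := (err x xc).1 i; rewrite !mxE.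
have hJ : has_jacobian (approx \- f) x (dapprox x - jac f x).
  by apply: has_jacobianB; [exact: approx_C1.1|exact: has_jacobian_jac].
rewrite (jacE xc hJ); apply: opnorm_le => i j; rewrite !mxE.
have := (err x xc).2 i j; rewrite !mxE; set u := dinterp _ _ _ _; set w := jac f x i j.
set e := t * _ => h.
have -> : u + e - w = (u + e - (w + e)) + e by ring.
apply: le_trans (ler_normD _ _) _; apply: lerD => //.
rewrite normrM gtr0_norm//; apply: ler_piMr; first exact: ltW.
by case: (_ == _); rewrite ?normr1 ?normr0.
Qed.

Lemma critical_approx_det x :
  (0 < m)%N -> critical_set approx x -> \det (dapprox_minor x) = 0.
Proof.
move=> m0 [xo rx]; apply: rank_det0.
have xc : cube R d x by move=> i; have /andP[? ?] := xo i; rewrite !ltW.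
rewrite (jacE xc (approx_C1.1 x xc)) in rx.
by apply: leq_ltn_trans rx _; rewrite subn1 prednK.
Qed.

End Approximation.

(** * Measure of the critical sets and choice of the mesh *)

Lemma jac_holder_finite (R : realType) d m (f : 'cV[R]_d -> 'cV[R]_m) alpha :
  (0 < d)%N -> (0 < m)%N -> C1alpha alpha f ->
  exists H : R, [/\ jac_holder alpha f = H%:E, 0 <= H &
    forall x y, cube R d x -> cube R d y -> x <> y ->
      opnorm (jac f x - jac f y) <= H * enorm (x - y) `^ alpha].
Proof.
move=> d0 m0 [_ fin].
have ub x y : cube R d x -> cube R d y -> x <> y ->
    ((opnorm (jac f x - jac f y) / enorm (x - y) `^ alpha)%:E
       <= jac_holder alpha f)%E.
  by move=> xc yc xy; apply: ereal_sup_ubound; exists (x, y).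
have ge0 : (0 <= jac_holder alpha f)%E.
  (* One pair of distinct points suffices: two opposite corners of the cube. *)
  apply: le_trans (ub (const_mx 0) (const_mx 1) _ _ _).
  - rewrite lee_fin divr_ge0 ?powR_ge0//.
    exact: le_trans (entry_le_opnorm _ (Ordinal m0) (Ordinal d0)).
  - by move=> i; rewrite mxE lexx ler01.
  - by move=> i; rewrite mxE lexx ler01.
  - move=> /matrixP/(_ (Ordinal d0) 0); rewrite !mxE => /eqP.
    by rewrite eq_sym oner_eq0.
have hfin : jac_holder alpha f \is a fin_num.
  by rewrite ge0_fin_numE.
exists (fine (jac_holder alpha f)); split; [by rewrite fineK|exact: fine_ge0|].
move=> x y xc yc xy.
have e0 : 0 < enorm (x - y).
  rewrite lt_neqAle enorm_ge0 andbT eq_sym; apply/eqP => e0; apply: xy.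
  apply/colP => j; apply/eqP; rewrite -subr_eq0 -normr_le0 -e0.
  by have := coord_le_enorm (x - y) j; rewrite !mxE.
rewrite -ler_pdivrMr ?powR_gt0// -lee_fin fineK//; exact: ub.
Qed.

Lemma hausdorff_critical_approx (R : realType) d : (0 < d)%N ->
  exists C : R, 0 <= C /\
  forall m n (t : R) (hmd : (m <= d)%N) (f : 'cV[R]_d -> 'cV[R]_m),
    (0 < m)%N -> (0 < n)%N ->
    (forall k : {ffun 'I_d -> 'I_n.+1},
       \det (\matrix_(i, j) jac f (node k) i (widen_ord hmd j) + t%:M) != 0) ->
    (hausdorff (d - 1) (critical_set (approx n t hmd f)) <= (C * n%:R)%:E)%E.
Proof.
move=> d0; have [C [C0 hC]] := hausdorff_cells R (d * (d * 3 + 1)).+1 d0.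
exists C; split=> // m n t hmd f m0 n0 ht.
have /choice[P hP] := fun l => poly_minor_cell t hmd f l n0.
apply: (hC n _ P n0 (fun l => (hP l).1)) => [l|x xcrit]; last first.
  have xc : cube R d x by move=> i; have /andP[? ?] := xcrit.1 i; rewrite !ltW.
  split=> // l lx; rewrite -(hP l).2; last exact: cell_coord_cube.
  by rewrite cell_pointK// critical_approx_det.
have zc : cube R d 0 by move=> i; rewrite mxE lexx ler01.
exists 0; rewrite -(hP l).2//.
(* The lowest corner of the cell is a node, and [ht] makes the minor nonzero there. *)
pose k := [ffun i => widen_ord (leqnSn n) (l i)] : {ffun 'I_d -> 'I_n.+1}.
have -> : cell_point l (0 : 'cV[R]_d) = node k.
  by apply/colP => i; rewrite !mxE addr0 ffunE.
by rewrite dapprox_minor_node.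
Qed.

Lemma hausdorff_set0 (R : realType) d k : (hausdorff k (set0 : set 'cV[R]_d) <= 0)%E.
Proof.
have := @hausdorff_le R d k set0 0; rewrite mulr0; apply => delta d0.
exists [::], 0; split=> //; first by rewrite !mulr0 ltW.
by rewrite mul0r.
Qed.

(** For H = 0 the Jacobian of [f] is constant, so the minor of the approximation is everywhere the
    one at a node. *)
Lemma critical_approx_set0 (R : realType) d m n (t : R) (hmd : (m <= d)%N)
    (f : 'cV[R]_d -> 'cV[R]_m) alpha :
  (0 < m)%N -> (0 < n)%N -> 0 < t -> C1 f -> 0 < alpha ->
  (forall x y, cube R d x -> cube R d y -> x <> y ->
     opnorm (jac f x - jac f y) <= 0 * enorm (x - y) `^ alpha) ->
  (forall k : {ffun 'I_d -> 'I_n.+1},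
     \det (\matrix_(i, j) jac f (node k) i (widen_ord hmd j) + t%:M) != 0) ->
  critical_set (approx n t hmd f) = set0.
Proof.
move=> m0 n0 t0 fC1 alpha0 hol ht; rewrite -subset0 => x xcrit.
have xc : cube R d x by move=> i; have /andP[? ?] := xcrit.1 i; rewrite !ltW.
pose k : {ffun 'I_d -> 'I_n.+1} := [ffun=> ord0].
have jacE : jac f x = jac f (node k).
  have [//|/eqP xk] := eqVneq (jac f x) (jac f (node k)).
  apply/matrixP => i j; apply/eqP; rewrite -subr_eq0 -normr_le0.
  have xk' : x <> node k by move=> xE; apply: xk; rewrite xE.
  have := hol x (node k) xc (node_cube R k n0) xk'; rewrite mul0r.
  by apply: le_trans; have := entry_le_opnorm (jac f x - jac f (node k)) i j; rewrite !mxE.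
have /eqP[] := ht k; rewrite -jacE.
rewrite -(critical_approx_det m0 xcrit); congr (\det _); apply/matrixP => i j.
have [_ /(_ i (widen_ord hmd j))] := approx_error hmd n0 t0 fC1 alpha0 (lexx 0) hol xc.
rewrite mul0r mulr0 normr_le0 subr_eq0 => /eqP dE.
by rewrite /dapprox_minor [RHS]mxE dE !mxE -[widen_ord hmd i == _]/(i == j) mulr_natr.
Qed.

Theorem theorem1p2 (R : realType) (d : nat) (alpha : R)
    (hd : (1 <= d)%N) (halpha : 0 < alpha <= 1) :
  exists C : R,
    forall (m : nat) (f : 'cV[R]_d -> 'cV[R]_m),
      (1 <= m <= d)%N -> C1alpha alpha f ->
      exists eps0 : R, 0 < eps0 /\
        forall eps : R, 0 < eps < eps0 ->
          (crit_inf f eps <=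
             C%:E * (jac_holder alpha f / eps%:E) `^ (alpha^-1))%E.
Proof.
have [C [C0 hC]] := hausdorff_critical_approx R hd.
have /andP[alpha0 _] := halpha.
have d0 : (0 : R) < d%:R by rewrite ltr0n.
(* Twice the 6 of [approx_C1norm]: half of [eps] goes to the Hölder error, half to the shift. *)
pose c : R := 12 * d%:R ^+ 3.
have c0 : 0 < c by rewrite mulr_gt0// exprn_gt0.
exists (C * (2 * (d%:R * c `^ alpha^-1))) => m f /andP[m0 hmd] fC.
have [H [HE H0 hol]] := jac_holder_finite hd m0 fC; have [fC1 _] := fC.
(* For H > 0 this threshold ensures 1 <= Y; for H = 0 the value 1 is arbitrary. *)
exists (if H == 0 then 1 else c * H); split.
  by case: eqVneq => // Hn0; rewrite mulr_gt0// lt_neqAle eq_sym Hn0.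
move=> eps /andP[eps0 epslt].
have HepsE : ((jac_holder alpha f / eps%:E) `^ alpha^-1 =
    ((H / eps) `^ alpha^-1)%:E)%E.
  by rewrite HE inver gt_eqF// -EFinM poweR_EFin.
rewrite HepsE -EFinM.
pose Y := (c * H / eps) `^ alpha^-1.
have Y0 : 0 <= Y by exact: powR_ge0.
have YE : Y = c `^ alpha^-1 * (H / eps) `^ alpha^-1.
  rewrite /Y -mulrA powRM//; first exact: ltW.
  by rewrite divr_ge0// ltW.
(* n > d Y makes c H (d / n)^alpha at most [eps]. *)
pose n := (Num.trunc (d%:R * Y)).+1.
have n0 : (0 < n)%N by [].
have nY : d%:R * Y < n%:R by exact: truncnS_gt.
have nn0 : (0 : R) < n%:R by rewrite ltr0n.
have tau0 : 0 < eps / (4 * d%:R ^+ 2) by rewrite divr_gt0// mulr_gt0// exprn_gt0.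
have [t /andP[t0 ttau] ht] := nonsingular_shift
  (fun k : {ffun 'I_d -> 'I_n.+1} =>
     \matrix_(i, j) jac f (node k) i (widen_ord hmd j)) tau0.
have small : c * (H * (d%:R / n%:R) `^ alpha) <= eps.
  have [->|Hn0] := eqVneq H 0; first by rewrite mul0r mulr0 ltW.
  have {Hn0}Hp : 0 < H by rewrite lt_neqAle eq_sym Hn0.
  have cH : 0 < c * H by rewrite mulr_gt0.
  have q1 : 0 <= c * H / eps by rewrite divr_ge0// ltW.
  have q2 : 0 <= eps / (c * H) by rewrite divr_ge0// ltW.
  pose Z := (eps / (c * H)) `^ alpha^-1.
  have YZ : Y * Z = 1.
    rewrite /Y /Z -powRM//.
    have -> : c * H / eps * (eps / (c * H)) = 1; last by rewrite powR1.
    by rewrite mulrA divfK ?divff// gt_eqF.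
  have dZ : d%:R / n%:R <= Z.
    rewrite ler_pdivrMr// (_ : d%:R = d%:R * Y * Z); last first.
      by rewrite -mulrA YZ mulr1.
    by rewrite [leRHS]mulrC; apply: ler_wpM2r; [exact: powR_ge0|exact: ltW nY].
  have : (d%:R / n%:R) `^ alpha <= Z `^ alpha.
    by apply: ge0_ler_powR; rewrite ?nnegrE ?powR_ge0 ?divr_ge0// ltW.
  rewrite /Z -powRrM mulVf ?gt_eqF// powRr1//.
  by rewrite ler_pdivlMr// mulrA mulrC.
have close : (C1norm (approx n t hmd f \- f)%R <= eps%:E)%E.
  apply: le_trans (approx_C1norm hmd n0 t0 hd fC1 alpha0 H0 hol) _.
  rewrite lee_fin; move: small; rewrite /c => small.
  have : 2 * d%:R ^+ 2 * t <= eps / 2.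
    rewrite mulrC -ler_pdivlMr ?mulr_gt0 ?exprn_gt0//.
    apply: le_trans (ltW ttau) _; rewrite le_eqVlt; apply/orP; left; apply/eqP.
    by field; rewrite gt_eqF.
  lra.
apply: le_trans (_ : (hausdorff (d - 1) (critical_set (approx n t hmd f)) <= _)%E).
  apply: ereal_inf_lbound; exists (approx n t hmd f); last by [].
  by split; [exact: (approx_C1 n t hmd f).2|exact: close].
have [H00|Hn0] := eqVneq H 0.
  rewrite H00 in hol *; rewrite (critical_approx_set0 m0 n0 t0 fC1 alpha0 hol ht).
  apply: le_trans (hausdorff_set0 _ _ _) _.
  by rewrite lee_fin !mulr_ge0 ?powR_ge0.
apply: le_trans (hC m n t hmd f m0 n0 ht) _; rewrite lee_fin -!mulrA.
rewrite -YE ler_wpM2l//; rewrite (negbTE Hn0) in epslt.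
have Y1 : 1 <= Y.
  have -> : 1 = 1 `^ alpha^-1 :> R by rewrite powR1.
  apply: ge0_ler_powR.
  - by rewrite invr_ge0 ltW.
  - by rewrite nnegrE.
  - by rewrite nnegrE divr_ge0 ?mulr_ge0// ltW.
  by rewrite ler_pdivlMr// mul1r ltW.
have dY : 1 <= d%:R * Y by rewrite -[leLHS]mulr1 ler_pM// ler1n.
(* As 1 <= d Y, this is at most 2 d Y, whence the 2 in the constant. *)
have : (n%:R : R) <= d%:R * Y + 1.
  by rewrite -natr1 lerD2r truncn_le (le_trans _ dY).
lra.
Qed.
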